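(* Let $U\in\mathcal{G}(X)$. Then $U=0$ in $\mathcal{G}(X)$ if and only if $U(\tilde p)=0$ in $\mathcal{K}$ for all $\tilde p\in\widetilde X_c$.
   Context: $\mathbb{K}$ denotes $\mathbb{R}$ or $\mathbb{C}$; $X$ is a paracompact smooth Hausdorff manifold of dimension $n$; $C^\infty(X)$ is the space of smooth $\mathbb{K}$-valued functions; $I=(0,1]$; $\mathcal{P}(X)$ is the space of linear differential operators $C^\infty(X)\to C^\infty(X)$. All $O$-estimates are for $\varepsilon\to 0$. $\mathcal{E}_M(X)$ (moderate nets) is the set of $(u_\varepsilon)_\varepsilon\in C^\infty(X)^I$ such that for every compact $L\subset X$ and every $P\in\mathcal{P}(X)$ there is $N\in\mathbb{N}$ with $\sup_{p\in L}|Pu_\varepsilon(p)|=O(\varepsilon^{-N})$. $\mathcal{N}(X)$ (negligible nets) is the set of $(u_\varepsilon)_\varepsilon\in C^\infty(X)^I$ such that for every compact $L\subset X$, every $P\in\mathcal{P}(X)$ and every $m\in\mathbb{N}$, $\sup_{p\in L}|Pu_\varepsilon(p)|=O(\varepsilon^{m})$. The (special) Colombeau algebra is $\mathcal{G}(X)=\mathcal{E}_M(X)/\mathcal{N}(X)$; the class of $(u_\varepsilon)_\varepsilon$ is written $\mathrm{cl}[(u_\varepsilon)_\varepsilon]$. The ring of generalized numbers $\mathcal{K}$ is the set of nets $(r_\varepsilon)_\varepsilon\in\mathbb{K}^I$ with $|r_\varepsilon|=O(\varepsilon^{-N})$ for some $N$, modulo nets with $|r_\varepsilon|=O(\varepsilon^m)$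 for each $m$. Fix any Riemannian metric $h$ on $X$ with Riemannian distance $d_h$ (the notions below do not depend on $h$). A net $(p_\varepsilon)_\varepsilon\in X^I$ is compactly supported if there are a compact $L\subset X$ and $\eta>0$ with $p_\varepsilon\in L$ for $\varepsilon<\eta$. Two compactly supported nets are equivalent, $(p_\varepsilon)_\varepsilon\sim(q_\varepsilon)_\varepsilon$, if $d_h(p_\varepsilon,q_\varepsilon)=O(\varepsilon^m)$ for each $m>0$. $\widetilde X_c$ denotes the set of equivalence classes (compactly supported generalized points). For $U=\mathrm{cl}[(u_\varepsilon)_\varepsilon]\in\mathcal{G}(X)$ and $\tilde p=\mathrm{cl}[(p_\varepsilon)_\varepsilon]\in\widetilde X_c$ the point value is $U(\tilde p):=\mathrm{cl}[(u_\varepsilon(p_\varepsilon))_\varepsilon]\in\mathcal{K}$ (this is well defined). *)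

(* Defs.v *)
From HB Require Import structures.
From mathcomp Require Import all_boot all_order all_algebra.
From mathcomp Require Import ring_quotient complex.
From mathcomp Require Import all_classical all_reals all_analysis.

Set Implicit Arguments.
Unset Strict Implicit.
Unset Printing Implicit Defensive.

Import Order.TTheory GRing.Theory Num.Theory.
Import numFieldNormedType.Exports.

Local Open Scope classical_set_scope.
Local Open Scope ring_scope.

(* A smooth manifold is a topological space X with a smooth atlas A; Hausdorff
   separation and paracompactness of X are separate hypotheses.               *)

Variant scalar_field := RealField | ComplexField.

Definition Kfield (R : realType) (k : scalar_field) : numFieldType :=
  match k with RealField => R : numFieldType | ComplexField => R[i] : numFieldType end.

Section Scalars.
Variables (R : realType).

Definition reK (k : scalar_field) : Kfield R k -> R :=
  match k with RealField => id | ComplexField => @complex.Re R end.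

Definition imK (k : scalar_field) : Kfield R k -> R :=
  match k with RealField => fun=> 0 | ComplexField => @complex.Im R end.

Definition mkK (k : scalar_field) : R -> R -> Kfield R k :=
  match k with RealField => fun a _ => a | ComplexField => fun a b => Complex a b end.

(* The norm of a numFieldType takes its values in the field itself. *)
Definition absK (k : scalar_field) (z : Kfield R k) : R := reK `|z|.

Lemma reKB k (z w : Kfield R k) : reK (z - w) = reK z - reK w.
Proof. by case: k z w => // -[a b] [c d]. Qed.

Lemma imKB k (z w : Kfield R k) : imK (z - w) = imK z - imK w.
Proof. by case: k z w => [z w|[a b] [c d]] //=; rewrite subrr. Qed.

Lemma reK0 k : reK (0 : Kfield R k) = 0. Proof. by case: k. Qed.
Lemma imK0 k : imK (0 : Kfield R k) = 0. Proof. by case: k. Qed.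

Lemma mkKK k (z : Kfield R k) : mkK k (reK z) (imK z) = z.
Proof. by case: k z => // -[a b]. Qed.

Lemma mkKB k (a b c d : R) :
  mkK k (a - c) (b - d) = mkK k a b - mkK k c d.
Proof. by case: k. Qed.

Lemma absK_ge0 k (z : Kfield R k) : 0 <= absK z.
Proof.
case: k z => [z|z]; first exact: normr_ge0.
by rewrite /absK; have := normr_ge0 z; rewrite lecE => /andP[].
Qed.

Lemma absK0 k : absK (0 : Kfield R k) = 0.
Proof. by rewrite /absK normr0 reK0. Qed.

Lemma absKB k (z w : Kfield R k) : absK (z - w) <= absK z + absK w.
Proof.
case: k z w => [z w|z w]; first exact: ler_normB.
rewrite /absK; have := ler_normB z w; rewrite lecE => /andP[_].
by case: `|z| => a b; case: `|w| => c d.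
Qed.

End Scalars.

Section SmoothEuclidean.
Variables (R : realType) (n : nat).
Implicit Types (D : set 'rV[R]_n) (f g : 'rV[R]_n -> R).

(* Iterated partial derivative: the head of the word is applied last. *)
Definition pderivs (s : seq 'I_n) f : 'rV[R]_n -> R :=
  foldr (fun i g => 'D_(delta_mx 0 i) g) f s.

Definition smooth_on D f : Prop :=
  forall (s : seq 'I_n) x, D x ->
    {for x, continuous (pderivs s f)} /\
    forall i : 'I_n, derivable (pderivs s f) x (delta_mx 0 i).

Definition smooth_onK k D (F : 'rV[R]_n -> Kfield R k) : Prop :=
  smooth_on D (@reK R k \o F) /\ smooth_on D (@imK R k \o F).

Definition pderivsK k (s : seq 'I_n) (F : 'rV[R]_n -> Kfield R k)
    (x : 'rV[R]_n) : Kfield R k :=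
  mkK k (pderivs s (@reK R k \o F) x) (pderivs s (@imK R k \o F) x).

Lemma pderivs_eq_on D f g : open D -> (forall x, D x -> f x = g x) ->
  forall s x, D x -> pderivs s f x = pderivs s g x.
Proof.
move=> oD fg; elim=> [|i s IH] x Dx /=; first exact: fg.
apply: near_eq_derive; apply: filterS (open_nbhs_nbhs (conj oD Dx)) => y Dy.
exact: IH.
Qed.

Lemma pderivsB D f g : open D -> smooth_on D f -> smooth_on D g ->
  forall s x, D x -> pderivs s (f - g) x = pderivs s f x - pderivs s g x.
Proof.
move=> oD sf sg; elim=> [|i s IH] x Dx //=.
transitivity ('D_(delta_mx 0 i) (pderivs s f - pderivs s g) x).
  apply: near_eq_derive.
  by apply: filterS (open_nbhs_nbhs (conj oD Dx)) => y Dy; exact: IH.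
by rewrite deriveB //; [exact: (sf s x Dx).2|exact: (sg s x Dx).2].
Qed.

Lemma smooth_onB D f g : open D -> smooth_on D f -> smooth_on D g ->
  smooth_on D (f - g).
Proof.
move=> oD sf sg s x Dx.
have nE : {near x, pderivs s f - pderivs s g =1 pderivs s (f - g)}.
  apply: filterS (open_nbhs_nbhs (conj oD Dx)) => y Dy.
  by rewrite (pderivsB oD sf sg).
split=> [|i].
  rewrite /prop_for /continuous_at -(nbhs_singleton nE).
  apply: cvg_trans (near_eq_cvg nE) _.
  by apply: cvgB; [exact: (sf s x Dx).1|exact: (sg s x Dx).1].
apply: (near_eq_derivable nE).
by apply: derivableB; [exact: (sf s x Dx).2|exact: (sg s x Dx).2].
Qed.

Lemma pderivs_cst (a : R) s :
  pderivs s (cst a) = cst (if s is [::] then a else 0).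
Proof.
elim: s => //= i s ->; apply/funext => x; case: s => [|_ _]; exact: derive_cst.
Qed.

Lemma smooth_on_cst D (a : R) : smooth_on D (cst a).
Proof.
move=> s x Dx; rewrite pderivs_cst; split=> [|i]; last exact: derivable_cst.
exact: cst_continuous.
Qed.

End SmoothEuclidean.

Definition paracompact (X : topologicalType) : Prop :=
  forall U : set (set X),
    (forall O, U O -> open O) -> \bigcup_(O in U) O = [set: X] ->
  exists V : set (set X),
    [/\ forall O, V O -> open O,
        \bigcup_(O in V) O = [set: X],
        forall O, V O -> exists2 O', U O' & O `<=` O' &
        forall x : X, exists2 W, nbhs x W &
          finite_set [set O | V O /\ O `&` W !=set0]].

(* The inverse of the coordinate map is a total function; only its restriction
   to the image of the chart domain is meaningful.                            *)
Record chart (R : realType) (n : nat) (X : topologicalType) := Chart {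
  chart_dom : set X ;
  chart_map :> X -> 'rV[R]_n ;
  chart_inv : 'rV[R]_n -> X ;
  chart_open_dom : open chart_dom ;
  chart_open_img : open (chart_map @` chart_dom) ;
  chart_mapK : forall p, chart_dom p -> chart_inv (chart_map p) = p ;
  chart_map_cont : forall p, chart_dom p -> {for p, continuous chart_map} ;
  chart_inv_cont : forall x, (chart_map @` chart_dom) x ->
    {for x, continuous chart_inv}
}.

Definition chart_img R n X (c : chart R n X) : set 'rV[R]_n :=
  c @` chart_dom c.

Record smooth_atlas (R : realType) (n : nat) (X : topologicalType) := Atlas {
  charts : set (chart R n X) ;
  charts_cover : forall p : X, exists2 c, charts c & chart_dom c p ;
  charts_compat : forall c c', charts c -> charts c' -> forall j : 'I_n,
    smooth_on (c @` (chart_dom c `&` chart_dom c'))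
      (fun x => c' (chart_inv c x) 0 j)
}.

Section SmoothFunctions.
Variables (R : realType) (n : nat) (X : topologicalType).
Variables (A : smooth_atlas R n X) (k : scalar_field).

Definition smooth (f : X -> Kfield R k) : Prop :=
  forall c, charts A c -> smooth_onK (chart_img c) (f \o chart_inv c).

Definition smooth_pred : {pred X -> Kfield R k} := [pred f | `[< smooth f >]].

Record Cinf := MkCinf { Cinf_fun :> X -> Kfield R k ;
                        Cinf_smooth : Cinf_fun \in smooth_pred }.

Lemma smooth_zmod_closed : zmod_closed smooth_pred.
Proof.
split.
  rewrite inE => c Ac; split.
    rewrite (_ : _ \o _ = cst 0); first exact: smooth_on_cst.
    by apply/funext => x /=; rewrite reK0.
  rewrite (_ : _ \o _ = cst 0); first exact: smooth_on_cst.
  by apply/funext => x /=; rewrite imK0.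
move=> f g; rewrite !inE => sf sg.
move=> c Ac.
have [[rf i_f] [rg ig]] := (sf c Ac, sg c Ac).
have oc : open (chart_img c) by exact: chart_open_img.
split.
  rewrite (_ : _ \o _ = (@reK R k \o (f \o chart_inv c))
     - (@reK R k \o (g \o chart_inv c))); first exact: smooth_onB.
  by apply/funext => x /=; rewrite reKB.
rewrite (_ : _ \o _ = (@imK R k \o (f \o chart_inv c))
   - (@imK R k \o (g \o chart_inv c))); first exact: smooth_onB.
by apply/funext => x /=; rewrite imKB.
Qed.

HB.instance Definition _ := GRing.isZmodClosed.Build _ smooth_pred
  smooth_zmod_closed.
HB.instance Definition _ := [isSub for Cinf_fun].
HB.instance Definition _ := [Choice of Cinf by <:].
HB.instance Definition _ := [SubChoice_isSubZmodule of Cinf by <:].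

(* P is of order at most r and has the local form
   (P u)(q) = sum_(|s| <= r) a_s(c q) (d_s (u o c^-1))(c q)
   with smooth coefficients near every point.  The sum ranges over words of
   directions instead of multi-indices (partial derivatives commute, so several
   words share one multi-index).  Linearity of P follows.                     *)
Definition diffop (P : Cinf -> Cinf) : Prop :=
  exists r : nat, forall p : X,
  exists (c : chart R n X) (W : set X)
         (a : seq 'I_n -> 'rV[R]_n -> Kfield R k),
    [/\ charts A c, open W, W p, W `<=` chart_dom c &
        (forall s, smooth_onK (c @` W) (a s)) /\
        forall (u : Cinf) (q : X), W q ->
          P u q = \sum_(j < r.+1) \sum_(s : j.-tuple 'I_n)
                    a s (c q) * pderivsK s (u \o chart_inv c) (c q)].

Lemma pderivsKB (u v : Cinf) (c : chart R n X) s q :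
  charts A c -> chart_dom c q ->
  pderivsK s ((u - v) \o chart_inv c) (c q) =
  pderivsK s (u \o chart_inv c) (c q) - pderivsK s (v \o chart_inv c) (c q).
Proof.
move=> Ac cq; rewrite /pderivsK -mkKB.
have := Cinf_smooth u; rewrite inE => su; have /asboolP sv := Cinf_smooth v.
have [[ru iu] [rv iv]] := (su c Ac, sv c Ac).
have Dq : chart_img c (c q) by exists q.
have oc : open (chart_img c) by exact: chart_open_img.
rewrite -(pderivsB oc ru rv) // -(pderivsB oc iu iv) //.
by congr mkK; congr pderivs; apply/funext => x /=; rewrite (reKB, imKB).
Qed.

Lemma diffopB P (u v : Cinf) p : diffop P -> P (u - v) p = P u p - P v p.
Proof.
move=> [r /(_ p)[c [W [a [Ac oW Wp Wc [_ PE]]]]]].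
rewrite !PE // -sumrB; apply: eq_bigr => j _; rewrite -sumrB.
by apply: eq_bigr => s _; rewrite pderivsKB ?mulrBr //; exact: Wc.
Qed.

Lemma diffop_id : diffop id.
Proof.
exists 0%N => p; have [c Ac cp] := charts_cover A p.
exists c, (chart_dom c), (fun _ => cst 1); split => //; first exact: chart_open_dom.
split=> [s|u q cq].
  by split; [exact: (smooth_on_cst (reK 1))|exact: (smooth_on_cst (imK 1))].
rewrite big_ord_recl big_ord0 addr0 (big_pred1 [tuple]) => [|s]; last first.
  by rewrite (tuple0 s) /= eqxx.
by rewrite mul1r /pderivsK /= chart_mapK // mkKK.
Qed.

End SmoothFunctions.

Arguments diffop {R n X A k}.

(* The index set ]0, 1] of nets. *)
Definition Ieps (R : realType) := {eps : R | 0 < eps <= 1}.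

(* f = O(g) as eps -> 0.  The functions f below are extended-real valued, as
   suprema and Riemannian distances are, and nonnegative (up to sup of the
   empty set being -oo).                                                      *)
Definition bigO (R : realType) (f : Ieps R -> \bar R) (g : R -> R) : Prop :=
  exists C eta : R, 0 < eta /\
    forall eps : Ieps R, val eps < eta -> (f eps <= (C * g (val eps))%:E)%E.

Section BigO.
Variable R : realType.

Lemma bigO_le0 (f : Ieps R -> \bar R) g :
  (forall eps, (f eps <= 0)%E) -> bigO f g.
Proof. by move=> f0; exists 0, 1; split=> // eps _; rewrite mul0r. Qed.

Lemma bigO_le (f f' : Ieps R -> \bar R) g :
  (forall eps, (f eps <= f' eps)%E) -> bigO f' g -> bigO f g.
Proof.
move=> ff' [C [eta [eta0 H]]]; exists C, eta; split=> // eps /H.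
exact: le_trans.
Qed.

Lemma bigOD (f f' : Ieps R -> \bar R) g :
  bigO f g -> bigO f' g -> bigO (fun eps => f eps + f' eps)%E g.
Proof.
move=> [C [eta [eta0 H]]] [C' [eta' [eta'0 H']]].
exists (C + C'), (Num.min eta eta'); split; first by rewrite lt_min eta0.
move=> eps; rewrite lt_min => /andP[/H h /H' h'].
by rewrite mulrDl EFinD; exact: leeD.
Qed.

Lemma bigO_weaken (f : Ieps R -> \bar R) (N N' : nat) : (N <= N')%N ->
  bigO f (fun e => e ^- N) -> bigO f (fun e => e ^- N').
Proof.
move=> NN' [C [eta [eta0 H]]]; exists `|C|, eta; split=> // eps /H.
move=> /le_trans; apply; rewrite lee_fin.
have /andP[e0 e1] := valP eps.
have en M : 0 <= val eps ^- M by rewrite invr_ge0 exprn_ge0 // ltW.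
apply: (@le_trans _ _ (`|C| * val eps ^- N)); first by rewrite ler_wpM2r ?ler_norm.
by rewrite ler_wpM2l// lef_pV2 ?posrE ?exprn_gt0// ler_wiXn2l// ltW.
Qed.

End BigO.

Section ColombeauAlgebra.
Variables (R : realType) (n : nat) (X : topologicalType).
Variables (A : smooth_atlas R n X) (k : scalar_field).

Definition supabs (L : set X) (f : X -> Kfield R k) : \bar R :=
  ereal_sup [set (absK (f p))%:E | p in L].

Definition moderate (u : Ieps R -> Cinf A k) : Prop :=
  forall (L : set X) (P : Cinf A k -> Cinf A k), compact L -> diffop P ->
    exists N : nat, bigO (fun eps => supabs L (P (u eps))) (fun e => e ^- N).

Definition negligible_net (u : Ieps R -> Cinf A k) : Prop :=
  forall (L : set X) (P : Cinf A k -> Cinf A k) (m : nat),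
    compact L -> diffop P ->
    bigO (fun eps => supabs L (P (u eps))) (fun e => e ^+ m).

Lemma supabsB (L : set X) (P : Cinf A k -> Cinf A k) (u v : Cinf A k) : diffop P ->
  (supabs L (P (u - v)%R) <= supabs L (P u) + supabs L (P v))%E.
Proof.
move=> dP; apply: ge_ereal_sup => _ [p Lp <-].
apply: (@le_trans _ _ ((absK (P u p))%:E + (absK (P v p))%:E)%E).
  by rewrite -EFinD lee_fin diffopB // absKB.
by apply: leeD; apply: ereal_sup_ubound; exists p.
Qed.

Lemma supabs0 (L : set X) (P : Cinf A k -> Cinf A k) : diffop P -> (supabs L (P 0%R) <= 0)%E.
Proof.
move=> dP; apply: ge_ereal_sup => _ [p Lp <-].
by rewrite -[X in P X](subrr 0) diffopB // subrr absK0.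
Qed.

Definition moderate_pred : {pred Ieps R -> Cinf A k} :=
  [pred u | `[< moderate u >]].

Record moderate_nets := ModerateNet {
  mnet :> Ieps R -> Cinf A k ; mnet_moderate : mnet \in moderate_pred }.

Lemma moderate_zmod_closed : zmod_closed moderate_pred.
Proof.
split.
  rewrite inE => L P cL dP; exists 0%N.
  by apply: bigO_le0 => eps; exact: supabs0.
move=> u v; rewrite !inE => mu mv L P cL dP.
have [N HN] := mu L P cL dP; have [N' HN'] := mv L P cL dP.
exists (maxn N N'); apply: bigO_le (fun eps => supabsB L (u eps) (v eps) dP) _.
apply: bigOD.
  by apply: bigO_weaken HN; exact: leq_maxl.
by apply: bigO_weaken HN'; exact: leq_maxr.
Qed.

HB.instance Definition _ := GRing.isZmodClosed.Build _ moderate_pred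
  moderate_zmod_closed.
HB.instance Definition _ := [isSub for mnet].
HB.instance Definition _ := [Choice of moderate_nets by <:].
HB.instance Definition _ := [SubChoice_isSubZmodule of moderate_nets by <:].

Definition negligible_pred : {pred moderate_nets} :=
  [pred u : moderate_nets | `[< negligible_net u >]].

Lemma negligible_zmod_closed : zmod_closed negligible_pred.
Proof.
split.
  rewrite inE => L P m cL dP.
  by apply: bigO_le0 => eps; exact: supabs0.
move=> u v; rewrite !inE => nu nv.
move=> L P m cL dP.
apply: bigO_le (fun eps => supabsB L (u eps) (v eps) dP) _.
by apply: bigOD; [exact: nu|exact: nv].
Qed.

HB.instance Definition _ := GRing.isZmodClosed.Build _ negligible_pred
  negligible_zmod_closed.

(* Quotient group; the product of the algebra is not needed below. *)
Definition colombeau_algebra := Quotient.quot negligible_pred.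

End ColombeauAlgebra.

Section GeneralizedNumbers.
Variables (R : realType) (k : scalar_field).

Definition moderate_num (r : Ieps R -> Kfield R k) : Prop :=
  exists N : nat, bigO (fun eps => (absK (r eps))%:E) (fun e => e ^- N).

Definition negligible_num (r : Ieps R -> Kfield R k) : Prop :=
  forall m : nat, bigO (fun eps => (absK (r eps))%:E) (fun e => e ^+ m).

Definition moderate_num_pred : {pred Ieps R -> Kfield R k} :=
  [pred r | `[< moderate_num r >]].

Record moderate_nums := ModerateNum {
  mnum :> Ieps R -> Kfield R k ; mnum_moderate : mnum \in moderate_num_pred }.

Lemma moderate_num_zmod_closed : zmod_closed moderate_num_pred.
Proof.
split.
  rewrite inE; exists 0%N; apply: bigO_le0 => eps.
  by rewrite absK0.
move=> r s; rewrite !inE => -[N HN] [N' HN']. 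
exists (maxn N N').
apply: (@bigO_le _ _ (fun eps => (absK (r eps))%:E + (absK (s eps))%:E)%E).
  by move=> eps; rewrite -EFinD lee_fin absKB.
apply: bigOD.
  by apply: bigO_weaken HN; exact: leq_maxl.
by apply: bigO_weaken HN'; exact: leq_maxr.
Qed.

HB.instance Definition _ := GRing.isZmodClosed.Build _ moderate_num_pred
  moderate_num_zmod_closed.
HB.instance Definition _ := [isSub for mnum].
HB.instance Definition _ := [Choice of moderate_nums by <:].
HB.instance Definition _ := [SubChoice_isSubZmodule of moderate_nums by <:].

Definition negligible_num_pred : {pred moderate_nums} :=
  [pred r : moderate_nums | `[< negligible_num r >]].

Lemma negligible_num_zmod_closed : zmod_closed negligible_num_pred.
Proof.
split.
  rewrite inE => m; apply: bigO_le0 => eps.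
  by rewrite absK0.
move=> r s; rewrite !inE => nr ns m.
apply: (@bigO_le _ _ (fun eps => (absK (r eps))%:E + (absK (s eps))%:E)%E).
  by move=> eps; rewrite -EFinD lee_fin absKB.
by apply: bigOD; [exact: nr|exact: ns].
Qed.

HB.instance Definition _ := GRing.isZmodClosed.Build _ negligible_num_pred
  negligible_num_zmod_closed.

Definition generalized_numbers := Quotient.quot negligible_num_pred.

End GeneralizedNumbers.

(* gram c (c p) is the Gram matrix at p of the metric in the coordinates c.
   Tangent vectors are row vectors, and v *m 'J f x is the image of v under
   the differential of f at x.                                                *)
Record riemannian_metric (R : realType) (n : nat) (X : topologicalType)
    (A : smooth_atlas R n X) := RiemannianMetric {
  gram : chart R n X -> 'rV[R]_n -> 'M[R]_n ;
  gram_smooth : forall c, charts A c -> forall i j : 'I_n,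
    smooth_on (chart_img c) (fun x => gram c x i j) ;
  gram_sym : forall c, charts A c -> forall x, chart_img c x ->
    (gram c x)^T = gram c x ;
  gram_pos : forall c, charts A c -> forall x, chart_img c x ->
    forall v : 'rV[R]_n, v != 0 -> 0 < (v *m gram c x *m v^T) 0 0 ;
  gram_compat : forall c c', charts A c -> charts A c' ->
    forall p, chart_dom c p -> chart_dom c' p ->
    let J := 'J (c' \o chart_inv c) (c p) in
    gram c (c p) = J *m gram c' (c' p) *m J^T
}.

Section RiemannianDistance.
Variables (R : realType) (n : nat) (X : topologicalType).
Variables (A : smooth_atlas R n X) (h : riemannian_metric A).

Definition chart_at (p : X) : chart R n X := projT1 (cid2 (charts_cover A p)).

(* C^1 on a neighbourhood of [0, 1]; a curve that is C^1 on [0, 1] in the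
   one-sided sense extends to such a neighbourhood.                           *)
Definition C1_curve (gam : R -> X) : Prop :=
  forall t : R, 0 <= t <= 1 ->
    {for t, continuous gam} /\
    forall c, charts A c -> chart_dom c (gam t) ->
      (\forall s \near t, derivable (c \o gam) s 1) /\
      {for t, continuous (derive1 (c \o gam))}.

Definition speed (gam : R -> X) (t : R) : R :=
  let c := chart_at (gam t) in
  let v := derive1 (c \o gam) t in
  Num.sqrt ((v *m gram h c (c (gam t)) *m v^T) 0 0).

Definition curve_length (gam : R -> X) : \bar R :=
  (\int[@lebesgue_measure R]_(t in `[0%R, 1%R]) (speed gam t)%:E)%E.

(* A piecewise C^1 curve from p to q, as the list of its C^1 pieces, each
   parametrized by [0, 1].                                                    *)
Fixpoint piecewise_C1 (p q : X) (s : seq (R -> X)) : Prop :=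
  match s with
  | [::] => p = q
  | gam :: s' => [/\ C1_curve gam, gam 0 = p & piecewise_C1 (gam 1) q s']
  end.

Definition piecewise_length (s : seq (R -> X)) : \bar R :=
  (\sum_(gam <- s) curve_length gam)%E.

(* +oo if p and q lie in different components. *)
Definition riemannian_distance (p q : X) : \bar R :=
  ereal_inf [set piecewise_length s | s in piecewise_C1 p q].

End RiemannianDistance.

Section GeneralizedPoints.
Variables (R : realType) (n : nat) (X : topologicalType).
Variables (A : smooth_atlas R n X) (h : riemannian_metric A).

Definition compactly_supported (p : Ieps R -> X) : Prop :=
  exists (L : set X) (eta : R), [/\ compact L, 0 < eta &
    forall eps : Ieps R, val eps < eta -> L (p eps)].

Definition csnets := {p : Ieps R -> X | compactly_supported p}.

Definition equiv_nets (p q : csnets) : Prop :=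
  forall m : nat, (0 < m)%N ->
    bigO (fun eps => riemannian_distance h (sval p eps) (sval q eps))
         (fun e => e ^+ m).

(* A class is a set of nets, so that no proof that equiv_nets is an equivalence
   relation is needed to form the type.                                       *)
Definition generalized_points :=
  {P : set csnets | exists p, P = [set q | equiv_nets p q]}.

Definition gp_repr (P : generalized_points) : csnets :=
  projT1 (cid (proj2_sig P)).

Variable k : scalar_field.

Definition eval_net (u : moderate_nets A k) (p : csnets) :
  Ieps R -> Kfield R k := fun eps => mnet u eps (sval p eps).

Lemma eval_net_moderate u p : eval_net u p \in @moderate_num_pred R k.
Proof.
rewrite inE. 
have := mnet_moderate u; rewrite inE => mu.
case: p => p [L [eta [cL eta0 pL]]].
have [N [C [eta' [eta'0 H]]]] := mu L id cL (diffop_id A k).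
exists N, C, (Num.min eta eta'); split; first by rewrite lt_min eta0.
move=> eps; rewrite lt_min => /andP[/pL Lp /H]; apply: le_trans.
by apply: ereal_sup_ubound; exists (p eps).
Qed.

(* The class of eval_net on one representative of each argument; it does not
   depend on the representatives.                                             *)
Definition point_value (U : colombeau_algebra A k) (P : generalized_points) :
  generalized_numbers R k :=
  (\pi_(generalized_numbers R k)
     (ModerateNum (eval_net_moderate (repr U) (gp_repr P))))%qT.

End GeneralizedPoints.

(* Main.v *)
Require Import Defs.
From HB Require Import structures.
From mathcomp Require Import all_boot all_order all_algebra.
From mathcomp Require Import all_classical all_reals all_analysis.
From mathcomp Require Import measurable_realfun ring lra.

(** Only the implication from vanishing point values to [U = 0] has content.
    Let [u] be a moderate net representing [U].

    A point value is computed on one representative of a generalized point, so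
    the first step is that negligibility of [u_eps(p_eps)] only depends on the
    class of the net [p] ([eval_net_equiv]).  This is a Lipschitz estimate
    [|u_eps(a) - u_eps(b)| <= C eps^-N d_h(a, b)], locally uniform in [a]
    ([moderate_lipschitz]).  In a chart it is the mean value inequality,
    provided that the chart distance is controlled by [d_h]: near a point the
    Gram matrix dominates a multiple of the identity ([quad_lower_near]), so
    that a curve has to spend a length proportional to the displacement of its
    chart image; in particular a short curve cannot leave the chart
    ([curve_confined]).

    Next, [u] is negligible uniformly on compact sets, without derivatives: if
    [|u_eps| > eps^m] somewhere on a compact set [L] for arbitrarily small
    [eps], picking such points gives a generalized point supported in [L] at
    which [u] does not vanish ([unifO_of_point_values]).

    Finally, for a moderate net the estimates on derivatives follow from those
    of order zero ([negligible_of_locO]).  For a step [t] the Landau inequality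
    bounds a first derivative by [2 sup|f| / t + t sup|f''|].  With [f''] of
    size [eps^-N] and [f] of size [eps^(2m+N)], the choice [t ~ eps^(m+N)] makes
    both terms of size [eps^m]; induction on the order of differentiation gives
    all iterated partial derivatives in a chart, hence all differential
    operators.  Moderateness is a statement about globally defined operators;
    it is brought to a chart by multiplying a chart derivative by a smooth bump
    function supported in the chart ([cutoff_op], [moderate_locO]). *)

Set Implicit Arguments.
Unset Strict Implicit.
Unset Printing Implicit Defensive.

Import Order.TTheory GRing.Theory Num.Theory.
Import numFieldNormedType.Exports.

Local Open Scope classical_set_scope.
Local Open Scope ring_scope.

(** * Directional derivatives and Frechet differentiability *)

Section LineDerivative.
Variables (R : realType) (V W : normedModType R).
Implicit Types (f : V -> W) (x v : V) (s : R).

(** Restriction to a line through [x] turns a directional derivative into a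
    derivative of a function of one real variable. *)
Lemma line_quotient f x v s :
  (fun h : R => h^-1 *: (((fun t => f (x + t *: v)) \o shift s) (h *: (1 : R)) -
    f (x + s *: v))) =
  (fun h : R => h^-1 *: ((f \o shift (x + s *: v)) (h *: v) - f (x + s *: v))).
Proof.
apply/funext => h /=.
by rewrite [h *: 1]mulr1 scalerDl [in RHS]addrCA.
Qed.

Lemma derivable_line f x v s :
  derivable (fun t : R => f (x + t *: v)) s (1 : R) <->
  derivable f (x + s *: v) v.
Proof. by rewrite /derivable line_quotient. Qed.

Lemma derive_line f x v s :
  'D_(1 : R) (fun t : R => f (x + t *: v)) s = 'D_v f (x + s *: v).
Proof. by rewrite /derive line_quotient. Qed.

End LineDerivative.

Lemma MVT_line (R : realType) (V : normedModType R) (f : V -> R) (x v : V)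
    (h : R) : (forall s : R, `|s| <= `|h| -> derivable f (x + s *: v) v) ->
  exists2 s : R, `|s| <= `|h| & f (x + h *: v) - f x = h * 'D_v f (x + s *: v).
Proof.
move=> df; pose g t := f (x + t *: v).
have dg (s : R) : `|s| <= `|h| -> is_derive s 1 g ('D_v f (x + s *: v)).
  by move=> /df ds; split; [exact/derivable_line|exact: derive_line].
have cg (s : R) : `|s| <= `|h| -> {for s, continuous g}.
  move=> /dg [dgs _]; apply: differentiable_continuous.
  exact/derivable1_diffP.
have g0 : g 0 = f x by rewrite /g scale0r addr0.
have [h0|h0] := leP 0 h.
  have I (s : R) : s \in `[0, h]%R -> `|s| <= `|h|.
    by rewrite in_itv /= => /andP[s0 sh]; rewrite !ger0_norm.
  have [||s shi] := @MVT_segment R g (fun s => 'D_v f (x + s *: v)) 0 h h0.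
  - by move=> s /subset_itv_oo_cc /I /dg.
  - apply: continuous_in_subspaceT => s /[1!inE] /=.
    by move=> s0h; apply: cg; apply: I.
  - by rewrite g0 subr0 => E; exists s; [exact: I|rewrite -/(g h) E mulrC].
have I (s : R) : s \in `[h, 0]%R -> `|s| <= `|h|.
  rewrite in_itv /= => /andP[sh s0].
  by rewrite (ler0_norm s0) (ltr0_norm h0) lerN2.
have [||s shi] := @MVT_segment R g (fun s => 'D_v f (x + s *: v)) h 0 (ltW h0).
- by move=> s /subset_itv_oo_cc /I /dg.
- apply: continuous_in_subspaceT => s /[1!inE] /=.
  by move=> s0h; apply: cg; apply: I.
- rewrite g0 sub0r => E; exists s; first exact: I.
  by apply: oppr_inj; rewrite opprB -/(g h) E mulrN mulrC.
Qed.

Section Coordinates.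
Variables (R : realType) (n : nat).
Implicit Types (f : 'rV[R]_n -> R) (x h v : 'rV[R]_n).

Lemma coord_le_norm x i : `|x 0 i| <= `|x|.
Proof.
by rewrite [leRHS]/Num.Def.normr/= mx_normrE; exact: (le_bigmax _ _ (0, i)).
Qed.

Lemma rV_norm_le x (r : R) : 0 <= r -> (forall i, `|x 0 i| <= r) -> `|x| <= r.
Proof.
move=> r0 xr; rewrite /Num.Def.normr/= mx_normrE.
by apply: bigmax_le => //= -[i j] _; rewrite ord1 /=.
Qed.

Lemma continuous_rV (T : topologicalType) (g : T -> 'rV[R]_n) (t : T) :
  (forall i, {for t, continuous (fun s => g s 0 i)}) -> {for t, continuous g}.
Proof.
move=> cg; apply/cvgrPdist_le => e e0; near=> s.
apply: rV_norm_le (ltW e0) _ => i; rewrite !mxE; move: i; near: s.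
apply: filter_forall => i.
exact: (cvgrPdist_le _ _).1 (cg i) _ e0.
Unshelve. all: by end_near. Qed.

Lemma continuous_coord (T : topologicalType) (g : T -> 'rV[R]_n) (t : T) i :
  {for t, continuous g} -> {for t, continuous (fun s => g s 0 i)}.
Proof.
move=> cg; exact: (cvg_comp _ _ cg (@coord_continuous R 1 n 0 i (g t))).
Qed.

(** The vectors [rV_trunc m h] interpolate between 0 and [h], changing one
    coordinate at a time. *)
Definition rV_trunc (m : nat) h : 'rV[R]_n :=
  \row_j (if (j < m)%N then h 0 j else 0).

Lemma rV_trunc0 h : rV_trunc 0 h = 0.
Proof. by apply/rowP => j; rewrite !mxE. Qed.

Lemma rV_trunc_full h : rV_trunc n h = h.
Proof. by apply/rowP => j; rewrite !mxE ltn_ord. Qed.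

Lemma rV_truncS (i : 'I_n) h : rV_trunc i.+1 h = rV_trunc i h + h 0 i *: 'e_i.
Proof.
apply/rowP => j; rewrite !mxE eqxx /= ltnS leq_eqVlt val_eqE.
by have [->|ij] := eqVneq j i; rewrite ?ltnn /= ?mulr1 ?add0r ?mulr0 ?addr0.
Qed.

(** Continuity of the partial derivatives at [x] is what makes the linear form
    with these coefficients a differential: the increment of [f] is split along
    the coordinate directions, and the mean value theorem is applied to each
    of the pieces. *)
Lemma C1_differentiable f x :
  (\forall y \near x, forall i : 'I_n, derivable f y 'e_i) ->
  (forall i : 'I_n, {for x, continuous ('D_('e_i) f)}) -> differentiable f x.
Proof.
move=> df cdf.
pose L h := \sum_i h 0 i * 'D_('e_i) f x.
have Llin : linear L.
  move=> a u v; rewrite /L scaler_sumr -big_split; apply: eq_bigr => i _ /=.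
  by rewrite !mxE mulrDl -mulrA.
pose Lm := GRing.isLinear.Build _ _ _ _ _ Llin.
pose LL : {linear 'rV[R]_n -> R} := HB.pack L Lm.
have cL : continuous L.
  apply: continuous_big => [|i _ y]; first exact: add_continuous.
    apply: (@continuousM R _ (fun h : 'rV[R]_n => h 0 i) (cst _) y).
      exact: coord_continuous.
    exact: cst_continuous.
have key : forall e : R, 0 < e -> \forall h \near (0 : 'rV[R]_n),
      `|(f \o shift x - (cst (f x) + L)) h| <= e * `|h|.
  move=> e e0.
  have n1 : 0 < n.+1%:R :> R by rewrite ltr0n.
  pose e' := e / n.+1%:R.
  have e'0 : 0 < e' by rewrite divr_gt0.
  have nD (i : 'I_n) :
      \forall y \near x, `|'D_('e_i) f x - 'D_('e_i) f y| <= e'.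
    exact: (cvgrPdist_le _ _).1 (cdf i) _ e'0.
  have : \forall y \near x, (forall i : 'I_n, derivable f y 'e_i) /\
      forall i : 'I_n, `|'D_('e_i) f x - 'D_('e_i) f y| <= e'.
    have nD2 := @filter_forall _ 'I_n
      (fun i y => `|'D_('e_i) f x - 'D_('e_i) f y| <= e') (nbhs x) _ nD.
    by near=> y; split; near: y; [exact: df|exact: nD2].
  case/nbhs_ballP => d /= d0 dP.
  apply/nbhs_ballP; exists d => // h.
  rewrite -ball_normE /ball_ /= sub0r normrN => hd.
  rewrite /= /cst !fctE /= opprD addrA.
  have inB (i : 'I_n) s : `|s| <= `|h 0 i| ->
      ball x d (x + rV_trunc i h + s *: 'e_i).
    move=> sh; rewrite -ball_normE /ball_ /=; apply: le_lt_trans hd.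
    rewrite opprD opprD !addrA subrr sub0r -opprD normrN.
    apply: rV_norm_le => // j; rewrite !mxE eqxx /=.
    case: (ltnP j i) => [ji|ij].
      rewrite -val_eqE /= (ltn_eqF ji) mulr0 addr0; exact: coord_le_norm.
    rewrite add0r; case: eqP => [_|_]; rewrite ?mulr1 ?mulr0 ?normr0 //.
    by apply: le_trans sh _; exact: coord_le_norm.
  have -> : f (h + x) - f x =
      \sum_(i < n) (f (x + rV_trunc i.+1 h) - f (x + rV_trunc i h)).
    rewrite -(big_mkord xpredT
      (fun i => f (x + rV_trunc i.+1 h) - f (x + rV_trunc i h))).
    rewrite (telescope_sumr (fun i => f (x + rV_trunc i h))) //.
    by rewrite rV_trunc_full rV_trunc0 addr0 [x + h]addrC.
  rewrite /L -sumrB; apply: le_trans (ler_norm_sum _ _ _) _.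
  apply: (@le_trans _ _ (\sum_(i < n) e' * `|h|)).
    apply: ler_sum => i _; rewrite rV_truncS addrA.
    have [s|s sh ->] := @MVT_line _ _ f (x + rV_trunc i h) 'e_i (h 0 i).
      by move=> /inB /dP [+ _]; exact.
    rewrite -mulrBr normrM mulrC.
    apply: ler_pM => //; last exact: coord_le_norm.
    by rewrite distrC; have /dP [_] := inB i s sh; exact.
  rewrite sumr_const card_ord -mulr_natr -mulrA (mulrC `|h|) mulrA.
  apply: ler_wpM2r => //; rewrite /e' mulrAC ler_pdivrMr // ler_pM2l //.
  by rewrite ler_nat.
have E : 'd f x = L :> (_ -> _).
  by apply: (@diff_unique _ _ _ f LL x cL); exact/eqaddoP.
by apply/diff_locallyP; rewrite E; split => //; exact/eqaddoP.
Unshelve. all: by end_near. Qed.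

End Coordinates.

Section ChainRule.
Variables (R : realType) (n : nat) (V : normedModType R).

(** The inner function is only required to have a derivative in the direction
    considered, as is the case of a map known through partial derivatives. *)
Lemma chain_direction (U W : normedModType R) (f : U -> W) (phi : V -> U)
    (x v : V) :
  derivable phi x v -> differentiable f (phi x) ->
  derivable (f \o phi) x v /\ 'D_v (f \o phi) x = 'd f (phi x) ('D_v phi x).
Proof.
move=> dphi df.
pose g t := phi (x + t *: v).
have xE : x = x + 0 *: v by rewrite scale0r addr0.
have g0 : g 0 = phi x by rewrite /g -xE.
have dg : differentiable g 0.
  by apply/derivable1_diffP/derivable_line; rewrite -xE.
have dfg0 : differentiable f (g 0) by rewrite g0.
have dfg : differentiable (f \o g) 0 by exact: differentiable_comp.
split.
  by rewrite [x in derivable _ x]xE; apply/derivable_line/derivable1_diffP.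
transitivity ('d (f \o g) 0 (1 : R)).
  by rewrite -deriveE // [in LHS]xE -[LHS](derive_line (f \o phi)).
transitivity ('d f (g 0) ('d g 0 (1 : R))); first by rewrite diff_comp.
by rewrite -[in 'd g 0 _]deriveE // derive_line -xE g0.
Qed.

Lemma diff_coords (W : normedModType R) (f : 'rV[R]_n -> W) (y w : 'rV[R]_n) :
  differentiable f y -> 'd f y w = \sum_j w 0 j *: 'D_('e_j) f y.
Proof.
move=> df; rewrite [w in LHS]row_sum_delta linear_sum /=.
by apply: eq_bigr => j _; rewrite linearZ /= deriveE.
Qed.

Lemma chain_coords (f : 'rV[R]_n -> R) (phi : V -> 'rV[R]_n) (x v : V) :
  (forall j, derivable (fun y => phi y 0 j) x v) -> differentiable f (phi x) ->
  derivable (f \o phi) x v /\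
  'D_v (f \o phi) x = \sum_j 'D_('e_j) f (phi x) * 'D_v (fun y => phi y 0 j) x.
Proof.
move=> dphij df.
have dphi : derivable phi x v by apply/derivable_mxP => i j; rewrite ord1.
have [dfp ->] := chain_direction dphi df; split=> //.
rewrite diff_coords //; apply: eq_bigr => j _.
by rewrite derive_mx // mxE mulrC.
Qed.

End ChainRule.

(** * Calculus of smooth functions *)

Section SmoothCalculus.
Variable R : realType.

(** Membership in this class is defined through the first derivatives, unlike
    [smooth_on], whose words of derivatives grow at the outer end; this is the
    form on which the Leibniz and chain rules allow an induction. *)
Fixpoint Ck n (k : nat) (D : set 'rV[R]_n) (f : 'rV[R]_n -> R) : Prop :=
  if k is k'.+1 then
    [/\ forall x, D x -> {for x, continuous f},
        forall x (i : 'I_n), D x -> derivable f x ('e_i) &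
        forall i : 'I_n, Ck k' D ('D_('e_i) f)]
  else True.

Section FixedDimension.
Variable n : nat.
Implicit Types (D : set 'rV[R]_n) (f g : 'rV[R]_n -> R) (x : 'rV[R]_n).

Lemma pderivs_rcons (s : seq 'I_n) i f :
  pderivs (rcons s i) f = pderivs s ('D_('e_i) f).
Proof. by rewrite /pderivs foldr_rcons. Qed.

Lemma smooth_on_continuous D f x :
  smooth_on D f -> D x -> {for x, continuous f}.
Proof. by move=> sf Dx; exact: (sf [::] x Dx).1. Qed.

Lemma smooth_on_derivable D f x (i : 'I_n) :
  smooth_on D f -> D x -> derivable f x 'e_i.
Proof. by move=> sf Dx; exact: (sf [::] x Dx).2. Qed.

Lemma smooth_on_derive D f i : smooth_on D f -> smooth_on D ('D_('e_i) f).
Proof.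
by move=> sf s x Dx; have := sf (rcons s i) x Dx; rewrite pderivs_rcons.
Qed.

Lemma smooth_on_pderivs D f s : smooth_on D f -> smooth_on D (pderivs s f).
Proof.
move=> sf t x Dx; have := sf (t ++ s) x Dx.
by rewrite /pderivs foldr_cat.
Qed.

Lemma smooth_onP D f : smooth_on D f <-> forall k, Ck k D f.
Proof.
split=> [sf k|].
  elim: k f sf => [//|k IH] f sf; split => [x Dx|x i Dx|i].
  - exact: (sf [::] x Dx).1.
  - exact: (sf [::] x Dx).2.
  - exact/IH/smooth_on_derive.
move=> + s; elim/last_ind: s f => [|s i IH] f sf x Dx.
  by have [c d _] := sf 1; split=> [|i]; [exact: c|exact: d].
rewrite pderivs_rcons; apply: IH => // k.
by have [_ _] := sf k.+1; exact.
Qed.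

Lemma Ck_ext k D f g : open D -> (forall x, D x -> f x = g x) ->
  Ck k D f -> Ck k D g.
Proof.
move=> oD; elim: k f g => [//|k IH] f g fg [cf df Cf].
have nfg x : D x -> {near x, f =1 g}.
  by move=> Dx; apply: filterS (open_nbhs_nbhs (conj oD Dx)) => y /fg.
split=> [x Dx|x i Dx|i].
- rewrite /prop_for /continuous_at -(fg x Dx).
  by apply: cvg_trans (near_eq_cvg (nfg x Dx)) _; exact: cf.
- by apply: near_eq_derivable (nfg x Dx) _; exact: df.
- by apply: IH (Cf i) => x Dx; exact: near_eq_derive (nfg x Dx).
Qed.

Lemma smooth_on_ext D f g : open D -> (forall x, D x -> f x = g x) ->
  smooth_on D f -> smooth_on D g.
Proof.
move=> oD fg /smooth_onP sf; apply/smooth_onP => k.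
exact: Ck_ext oD fg (sf k).
Qed.

Lemma smooth_on_local f D : (forall x, D x -> exists2 E, smooth_on E f & E x) ->
  smooth_on D f.
Proof. by move=> H s x /H[E sf Ex]; exact: sf. Qed.

Lemma CkD k D f g : open D -> Ck k D f -> Ck k D g -> Ck k D (f + g).
Proof.
move=> oD; elim: k f g => [//|k IH] f g [cf df Cf] [cg dg Cg].
split=> [x Dx|x i Dx|i].
- by apply: continuousD; [exact: cf|exact: cg].
- by apply: derivableD; [exact: df|exact: dg].
- apply: Ck_ext (IH _ _ (Cf i) (Cg i)) => // x Dx.
  by rewrite deriveD //; [exact: df|exact: dg].
Qed.

Lemma Ck_pred k D f : Ck k.+1 D f -> Ck k D f.
Proof.
elim: k f => [//|k IH] f [cf df Cf]; split=> // i; exact/IH/Cf.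
Qed.

Lemma CkM k D f g : open D -> Ck k D f -> Ck k D g -> Ck k D (f * g).
Proof.
move=> oD; elim: k f g => [//|k IH] f g Cf Cg.
have [[cf df Df] [cg dg Dg]] := (Cf, Cg).
split=> [x Dx|x i Dx|i].
- by apply: continuousM; [exact: cf|exact: cg].
- by apply: derivableM; [exact: df|exact: dg].
- have Cfg := IH _ _ (Ck_pred Cf) (Dg i).
  have Cgf := IH _ _ (Ck_pred Cg) (Df i).
  apply: Ck_ext (CkD oD Cfg Cgf) => // x Dx.
  by rewrite deriveM //; [exact: df|exact: dg].
Qed.

Lemma smooth_onM D f g : open D -> smooth_on D f -> smooth_on D g ->
  smooth_on D (f * g).
Proof.
move=> oD /smooth_onP sf /smooth_onP sg; apply/smooth_onP => k.
exact: CkM.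
Qed.

Lemma Ck_cst k D (a : R) : Ck k D (cst a).
Proof. by move: k; apply/smooth_onP; exact: smooth_on_cst. Qed.

Lemma Ck_sum (I : Type) (r : seq I) k D (F : I -> 'rV[R]_n -> R) :
  open D -> (forall i, Ck k D (F i)) ->
  Ck k D (fun x => \sum_(i <- r) F i x).
Proof.
move=> oD sF; elim: r => [|i r IH].
  by apply: (Ck_ext oD _ (Ck_cst k D 0)) => x _; rewrite big_nil.
by apply: (Ck_ext oD _ (CkD oD (sF i) IH)) => x _; rewrite big_cons.
Qed.

Lemma smooth_on_prod (I : Type) (r : seq I) D (F : I -> 'rV[R]_n -> R) :
  open D -> (forall i, smooth_on D (F i)) ->
  smooth_on D (fun x => \prod_(i <- r) F i x).
Proof.
move=> oD sF; elim: r => [|i r IH].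
  apply: (smooth_on_ext oD _ (@smooth_on_cst R n D 1)) => x _.
  by rewrite big_nil.
apply: (smooth_on_ext oD _ (smooth_onM oD (sF i) IH)) => x _.
by rewrite big_cons.
Qed.

Lemma smooth_on_coord D (i : 'I_n) : open D -> smooth_on D (fun x => x 0 i).
Proof.
move=> oD.
have dc x (j : 'I_n) :
    is_derive x ('e_j) (fun x : 'rV[R]_n => x 0 i) (i == j)%:R.
  have did : derivable (@id 'rV[R]_n) x ('e_j) by exact: derivable_id.
  split; first by have /derivable_mxP := did; exact.
  transitivity (('D_('e_j) (@id 'rV[R]_n) x) 0 i).
    by rewrite derive_mx // mxE.
  by rewrite derive_id mxE eqxx.
apply/smooth_onP => -[//|k]; split=> [x Dx|x j Dx|j].
- exact: coord_continuous.
- by have [] := dc x j.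
- apply: (Ck_ext oD _ (Ck_cst k D (i == j)%:R)) => x _.
  by have [_ ->] := dc x j.
Qed.

Lemma smooth_on_differentiable D f x : open D -> smooth_on D f -> D x ->
  differentiable f x.
Proof.
move=> oD sf Dx; apply: C1_differentiable => [|i].
  by apply: filterS (open_nbhs_nbhs (conj oD Dx)) => y /(sf [::] y)[].
exact: (sf [:: i] x Dx).1.
Qed.

End FixedDimension.

(** By the chain rule a derivative of [f \o phi] is a sum of products of
    [('D_j f) \o phi], to which the induction on the order of differentiability
    applies, with derivatives of the components of [phi]. *)
Lemma smooth_on_comp m n (D : set 'rV[R]_m) (E : set 'rV[R]_n)
    (phi : 'rV[R]_m -> 'rV[R]_n) (f : 'rV[R]_n -> R) : open D -> open E ->
  (forall x, D x -> E (phi x)) ->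
  (forall j, smooth_on D (fun x => phi x 0 j)) -> smooth_on E f ->
  smooth_on D (f \o phi).
Proof.
move=> oD oE DE sphi sf; apply/smooth_onP => k.
elim: k f sf => [//|k IH] f sf.
have chain x (i : 'I_m) : D x -> derivable (f \o phi) x 'e_i /\
    'D_('e_i) (f \o phi) x =
    \sum_j 'D_('e_j) f (phi x) * 'D_('e_i) (fun y => phi y 0 j) x.
  move=> Dx; apply: chain_coords => [j|]; first exact: (sphi j [::] x Dx).2.
  exact: smooth_on_differentiable oE sf (DE x Dx).
split=> [x Dx|x i Dx|i].
- apply: continuous_comp.
    by apply: continuous_rV => j; exact: (sphi j [::] x Dx).1.
  exact: (sf [::] _ (DE x Dx)).1.
- exact: (chain x i Dx).1.
- apply: (Ck_ext oD _ (Ck_sum (index_enum 'I_n) (k := k) (F := fun j =>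
    ('D_('e_j) f \o phi) * 'D_('e_i) (fun y => phi y 0 j)) oD _)) => [x Dx|j].
    by have [_ ->] := chain x i Dx.
  apply: CkM => //; first by apply: IH; exact: smooth_on_derive.
  by move: k {IH}; apply/smooth_onP; exact: smooth_on_derive.
Qed.

End SmoothCalculus.

(** * A smooth bump function *)

Section FlatFunctions.
Variable R : realType.

(** Beside [exp (- 1 / x)], the products with powers of [1 / x] are needed for
    the family to be stable under differentiation. *)
Definition flat (k : nat) (x : R) : R :=
  if 0 < x then x^-1 ^+ k * expR (- x^-1) else 0.

Lemma flat_gt0 x : 0 < x -> 0 < flat 0 x.
Proof. by move=> x0; rewrite /flat x0 expr0 mul1r expR_gt0. Qed.

Lemma flat_le0 k x : x <= 0 -> flat k x = 0.
Proof. by move=> x0; rewrite /flat ltNge x0. Qed.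

Lemma flat_ge0 k x : 0 <= flat k x.
Proof.
rewrite /flat; case: ifP => // x0.
by rewrite mulr_ge0 ?expR_ge0 // exprn_ge0 // invr_ge0 ltW.
Qed.

(** A quadratic bound gives continuity and a zero derivative at the origin; it
    holds because [exp y] dominates [y ^ (k + 2) / (k + 2)!] for [y = 1 / x]. *)
Lemma flat_le_sqr k x : flat k x <= (k.+2)`!%:R * x ^+ 2.
Proof.
rewrite /flat; case: ifPn => x0; last by rewrite mulr_ge0 ?sqr_ge0.
set y := x^-1.
have y0 : 0 < y by rewrite invr_gt0.
have yk : y ^+ k.+2 <= (k.+2)`!%:R * expR y.
  rewrite -ler_pdivrMl ?ltr0n ?fact_gt0 // mulrC.
  by apply: le_trans (expR_ge1Dxn k.+1 (ltW y0)); rewrite lerDr.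
have -> : x = y^-1 by rewrite invrK.
clearbody y.
rewrite expRN ler_pdivrMr ?expR_gt0 // exprVn mulrAC ler_pdivlMr ?exprn_gt0 //.
by rewrite -exprD addn2.
Qed.

Lemma is_derive_flat k (x : R) :
  is_derive x (1 : R) (flat k) (flat k.+2 x - k%:R * flat k.+1 x).
Proof.
have [x0|x0|->] := ltgtP x 0.
- rewrite !flat_le0 ?mulr0 ?subr0; [|exact: ltW..].
  apply: (@near_eq_is_derive _ _ _ (cst 0)).
  apply: filterS (open_nbhs_nbhs (conj (@open_lt R 0) x0)) => y.
  by move=> /ltW /flat_le0.
- pose G (y : R) := y ^+ k * expR (- y).
  have dG (y : R) : is_derive y 1 G
      (k%:R * y ^+ k.-1 * expR (- y) - y ^+ k * expR (- y)).
    have dX := is_deriveX k (is_derive_id y (1 : R)).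
    have dE : is_derive y 1 (expR \o -%R) (expR (- y) * -1).
      by apply: is_derive1_comp; exact: is_deriveN.
    have := is_deriveM dX dE; rewrite /G; set a := _ *: _ + _ => da.
    have -> : k%:R * y ^+ k.-1 * expR (- y) - y ^+ k * expR (- y) = a.
      rewrite /a /= addrC [_ *: 1]mulr1 /GRing.scale /=; congr (_ + _).
        by rewrite mulrN1 mulrN fctE.
      by rewrite mulrC.
    by apply: near_eq_is_derive da; near=> z; rewrite !fctE.
  have dg : is_derive x 1 (fun y : R => y^-1) (- x ^- 2).
    have := is_deriveV (f := id) (lt0r_neq0 x0) (is_derive_id x (1 : R)).
    by rewrite [_ *: _]mulr1.
  have := is_derive1_comp (dG _) dg; set a := _ * _ => da.
  have -> : flat k.+2 x - k%:R * flat k.+1 x = a.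
    rewrite /a /flat x0 -exprVn.
    by case: (k) => [|j] /=; rewrite ?exprS; ring.
  apply: near_eq_is_derive da.
  apply: filterS (open_nbhs_nbhs (conj (@open_gt R 0) x0)) => y /= y0.
  by rewrite /flat y0.
- rewrite !flat_le0 // mulr0 subr0.
  have lim0 : h^-1 *: ((flat k \o shift 0) (h *: (1 : R)) - flat k 0)
      @[h --> 0^'] --> (0 : R).
    apply/cvgrPdist_le => /= e e0.
    have M0 : 0 < (k.+2)`!%:R :> R by rewrite ltr0n fact_gt0.
    near=> h.
    have h0 : h != 0 by near: h; exact: nbhs_dnbhs_neq.
    have he : `|h| < e / (k.+2)`!%:R.
      by near: h; apply: dnbhs0_lt; rewrite divr_gt0.
    rewrite addr0 [_ *: 1]mulr1 (flat_le0 k (lexx 0)) subr0 sub0r normrN.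
    rewrite normrZ normfV mulrC ler_pdivrMr ?normr_gt0 //.
    rewrite ger0_norm ?flat_ge0 //.
    apply: le_trans (flat_le_sqr _ _) _.
    rewrite -real_normK ?num_real // expr2 mulrA.
    by rewrite ler_wpM2r // -ler_pdivlMl // mulrC ltW.
  by split; [apply/cvg_ex; exists 0|exact/cvg_lim].
Unshelve. all: by end_near. Qed.
End FlatFunctions.

Lemma smooth_on_flat (R : realType) n (D : set 'rV[R]_n) (g : 'rV[R]_n -> R) k :
  open D -> smooth_on D g -> smooth_on D (flat k \o g).
Proof.
move=> oD sg; apply/smooth_onP => m; elim: m k => [//|m IH] k.
have chain x (i : 'I_n) : D x -> derivable (flat k \o g) x 'e_i /\
    'D_('e_i) (flat k \o g) x =
    (flat k.+2 (g x) - k%:R * flat k.+1 (g x)) * 'D_('e_i) g x.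
  move=> Dx; have [dF dFE] := is_derive_flat k (g x).
  have dF' : differentiable (flat k) (g x) by exact/derivable1_diffP.
  have dg := smooth_on_derivable (i := i) sg Dx.
  have [dk ->] := chain_direction dg dF'; split=> //.
  by rewrite diff1E // derive1E dFE; exact: mulrC.
split=> [x Dx|x i Dx|i].
- apply: continuous_comp; first exact: smooth_on_continuous sg Dx.
  have [dF _] := is_derive_flat k (g x).
  exact/differentiable_continuous/derivable1_diffP.
- exact: (chain x i Dx).1.
- have Cg : Ck m D ('D_('e_i) g).
    by move: m {IH}; apply/smooth_onP; exact: smooth_on_derive.
  have Ckf := CkM oD (Ck_cst m D (- k%:R)) (IH k.+1).
  apply: (Ck_ext oD _ (CkM oD (CkD oD (IH k.+2) Ckf) Cg)) => x Dx.
  by have [_ ->] := chain x i Dx; rewrite !fctE mulNr.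
Qed.

Section Bump.
Variables (R : realType) (n : nat) (a : 'rV[R]_n) (r : R).
Hypothesis r_gt0 : 0 < r.

(** The support is the closed ball of radius [r] around [a] for the sup norm,
    which is the norm of row vectors. *)
Definition bump (x : 'rV[R]_n) : R :=
  \prod_(i < n) flat 0 (r ^+ 2 - (x 0 i - a 0 i) ^+ 2).

Lemma smooth_on_bump (D : set 'rV[R]_n) : open D -> smooth_on D bump.
Proof.
move=> oD; apply: smooth_on_prod => // i.
apply: (@smooth_on_flat _ _ _ (fun x => r ^+ 2 - (x 0 i - a 0 i) ^+ 2)) => //.
have sx : smooth_on D (fun x => x 0 i - a 0 i).
  exact: (smooth_onB oD (@smooth_on_coord R n D i oD)
    (@smooth_on_cst R n D (a 0 i))).
exact: (smooth_onB oD (@smooth_on_cst R n D (r ^+ 2)) (smooth_onM oD sx sx)).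
Qed.

Lemma bump_gt0 x : `|x - a| < r -> 0 < bump x.
Proof.
move=> xa; apply: prodr_gt0 => i _; apply: flat_gt0.
rewrite subr_gt0 -real_normK ?num_real //.
rewrite ltr_pXn2r ?nnegrE ?(ltW r_gt0) //.
by apply: le_lt_trans xa; have := coord_le_norm (x - a) i; rewrite !mxE.
Qed.

Lemma bump_eq0 x : r < `|x - a| -> bump x = 0.
Proof.
move=> rx; have [i xi] : exists i : 'I_n, r < `|x 0 i - a 0 i|.
  apply: contrapT => /forallNP H; move: rx; rewrite ltNge => /negP; apply.
  apply: rV_norm_le (ltW r_gt0) _ => i.
  by rewrite !mxE leNgt; apply/negP; exact: H.
rewrite /bump (bigD1 i) //= flat_le0 ?mul0r // subr_le0.
rewrite -[leRHS]real_normK ?num_real //.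
by rewrite ler_pXn2r ?nnegrE ?(ltW r_gt0) // ltW.
Qed.

End Bump.

(** * Locally uniform estimates on nets of functions *)

Lemma archi_bound (R : realType) (x : R) : exists N : nat, x <= N%:R.
Proof.
exists (Num.truncn `|x|).+1; apply: le_trans (ler_norm _) _.
by apply: ltW; exact: truncnS_gt.
Qed.

Lemma archi_invS (R : realType) (x : R) : 0 < x ->
  exists N : nat, N.+1%:R^-1 <= x.
Proof.
move=> x0; have [N xN] := archi_bound x^-1; exists N.
rewrite -[leRHS]invrK lef_pV2 ?posrE ?invr_gt0 ?ltr0n //.
by apply: le_trans xN _; rewrite ler_nat.
Qed.

Lemma expNr_weaken (R : realType) (e : R) (N M : nat) :
  0 < e <= 1 -> (N <= M)%N -> e ^- N <= e ^- M.
Proof.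
move=> /andP[e0 e1] NM.
by rewrite lef_pV2 ?posrE ?exprn_gt0 // ler_wiXn2l // ltW.
Qed.

(** A single integer encodes the constants of an estimate (bounds, exponents,
    inverses of thresholds), which a finite subcover then makes uniform. *)
Lemma compact_eventually (T : topologicalType) (L : set T)
    (P : nat -> T -> Prop) :
  compact L ->
  (forall x, L x -> exists2 V, nbhs x V &
     exists N : nat, forall M, (N <= M)%N -> forall y, V y -> P M y) ->
  exists M, forall y, L y -> P M y.
Proof.
move=> /compact_near_coveringP cL H.
have [x Lx|N _ HN] := cL nat \oo P _; last first.
  by exists N => y Ly; exact: (HN N (leqnn N) y Ly).
have [V xV [N HV]] := H x Lx; exists (V, [set M | (N <= M)%N]).
  by split=> //=; exists N.
by case=> y M /= [Vy NM]; exact: HV.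
Qed.

Section UniformO.
Variable R : realType.

Definition unifO (T : Type) (V : set T) (F : Ieps R -> T -> R) (g : R -> R) :=
  exists C eta : R, 0 < eta /\
    forall eps, val eps < eta -> forall y, V y -> `|F eps y| <= C * g (val eps).

Definition locO (T : topologicalType) (x : T) (F : Ieps R -> T -> R)
    (g : R -> R) :=
  exists2 V, nbhs x V & unifO V F g.

Lemma unifO_sub (T : Type) (V V' : set T) F g :
  V `<=` V' -> unifO V' F g -> unifO V F g.
Proof.
move=> VV' [C [eta [e0 H]]]; exists C, eta; split=> // eps /H + y /VV'.
exact.
Qed.

Lemma unifO_le (T : Type) (V : set T) (F F' : Ieps R -> T -> R) g :
  (forall eps y, V y -> `|F eps y| <= `|F' eps y|) ->
  unifO V F' g -> unifO V F g.
Proof.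
move=> FF' [C [eta [e0 H]]]; exists C, eta; split=> // eps /H{}H y Vy.
exact: le_trans (FF' _ _ Vy) (H y Vy).
Qed.

Lemma unifO0 (T : Type) (V : set T) g : unifO V (fun _ _ => 0) g.
Proof. by exists 0, 1; split=> // eps _ y _; rewrite normr0 mul0r. Qed.

Lemma unifOD (T : Type) (V : set T) F F' g :
  unifO V F g -> unifO V F' g -> unifO V (fun eps y => F eps y + F' eps y) g.
Proof.
move=> [C [eta [e0 H]]] [C' [eta' [e0' H']]].
exists (C + C'), (Num.min eta eta'); split; first by rewrite lt_min e0.
move=> eps; rewrite lt_min => /andP[/H{}H /H'{}H'] y Vy.
by rewrite mulrDl; apply: le_trans (ler_normD _ _) (lerD (H y Vy) (H' y Vy)).
Qed.

Lemma locO_le (T : topologicalType) (x : T) (F F' : Ieps R -> T -> R) g :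
  (\forall y \near x, forall eps, `|F eps y| <= `|F' eps y|) ->
  locO x F' g -> locO x F g.
Proof.
move=> FF' [V xV OV].
exists (V `&` [set y | forall eps, `|F eps y| <= `|F' eps y|]).
  exact: filterI.
apply: (@unifO_le _ _ _ F') => [eps y [_]|]; first exact.
exact: unifO_sub OV.
Qed.

Lemma locO_leT (T : topologicalType) (x : T) (F F' : Ieps R -> T -> R) g :
  (forall eps y, `|F eps y| <= `|F' eps y|) -> locO x F' g -> locO x F g.
Proof. by move=> FF' [V xV OV]; exists V => //; exact: unifO_le OV. Qed.

Lemma locO0 (T : topologicalType) (x : T) g : locO x (fun _ _ => 0) g.
Proof. by exists setT; [exact: filterT|exact: unifO0]. Qed.

Lemma locOD (T : topologicalType) (x : T) F F' g :
  locO x F g -> locO x F' g -> locO x (fun eps y => F eps y + F' eps y) g.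
Proof.
move=> [V xV OV] [V' xV' OV']; exists (V `&` V'); first exact: filterI.
by apply: unifOD; [apply: unifO_sub OV|apply: unifO_sub OV'] => ? [].
Qed.

Lemma locO_sum (T : topologicalType) (I : Type) (r : seq I) (x : T) F g :
  (forall i, locO x (F i) g) ->
  locO x (fun eps y => \sum_(i <- r) F i eps y) g.
Proof.
move=> H; elim: r => [|i r IH].
  by apply: locO_leT (locO0 x g) => eps y; rewrite big_nil.
by apply: locO_leT (locOD (H i) IH) => eps y; rewrite big_cons.
Qed.

Lemma locO_comp (T U : topologicalType) (h : T -> U) (x : T) F g :
  {for x, continuous h} -> locO (h x) F g ->
  locO x (fun eps y => F eps (h y)) g.
Proof.
move=> ch [V xV [C [eta [e0 H]]]]; exists (h @^-1` V); first exact: ch.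
by exists C, eta; split=> // eps /H{}H y; exact: H.
Qed.

Lemma locO_mull (T : topologicalType) (x : T) (a : T -> R) F g :
  {for x, continuous a} ->
  locO x F g -> locO x (fun eps y => a y * F eps y) g.
Proof.
move=> ca [V xV [C [eta [e0 H]]]].
exists (V `&` [set y | `|a x - a y| <= 1]).
  by apply: filterI => //; exact: (cvgrPdist_le _ _).1 ca _ ltr01.
exists ((`|a x| + 1) * C), eta; split=> // eps /H{}H y [Vy ay].
rewrite normrM -mulrA ler_pM //; last exact: H.
rewrite -lerBlDl; apply: le_trans ay.
by rewrite distrC; exact: lerB_dist.
Qed.

Lemma locO_weaken (T : topologicalType) (x : T) F (N M : nat) : (N <= M)%N ->
  locO x F (fun e => e ^- N) -> locO x F (fun e => e ^- M).
Proof.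
move=> NM [V xV [C [eta [eta0 H]]]]; exists V => //.
exists `|C|, eta; split=> // eps /H{}H y /H{}H; apply: le_trans H _.
have /andP[e0 _] := valP eps.
apply: le_trans (ler_wpM2l (normr_ge0 C) (expNr_weaken (valP eps) NM)).
by rewrite ler_wpM2r ?ler_norm // invr_ge0 exprn_ge0 // ltW.
Qed.

Lemma compact_locO (T : topologicalType) (L : set T) F g :
  (forall e : R, 0 < e -> 0 <= g e) -> compact L ->
  (forall x, L x -> locO x F g) -> unifO L F g.
Proof.
move=> g0 cL H.
pose P (M : nat) y := forall eps : Ieps R, val eps < M.+1%:R^-1 ->
  `|F eps y| <= M%:R * g (val eps).
have [M HM] : exists M, forall y, L y -> P M y.
  apply: (compact_eventually cL) => x Lx.
  have [V xV [C [eta [eta0 HV]]]] := H x Lx.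
  have [N1 N1C] := archi_bound C; have [N2 N2e] := archi_invS eta0.
  exists V => //; exists (maxn N1 N2) => M; rewrite geq_max => /andP[N1M N2M].
  move=> y Vy eps epsM; have /andP[eps0 _] := valP eps.
  have epse : val eps < eta.
    apply: lt_le_trans epsM (le_trans _ N2e).
    by rewrite lef_pV2 ?posrE ?ltr0n // ler_nat.
  apply: le_trans (HV eps epse y Vy) _; rewrite ler_wpM2r ?g0 //.
  by apply: le_trans N1C _; rewrite ler_nat.
exists M%:R, M.+1%:R^-1; split=> [|eps epsM y Ly]; last exact: HM.
by rewrite invr_gt0 ltr0n.
Qed.

End UniformO.

(** * Derivatives of negligible nets with moderate derivatives *)

(** The mean value theorem gives a point at distance at most [t] where the
    derivative is the slope, of size [2 * B0 / t]; going back to [x] costs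
    [t * B2] by the mean value theorem for the derivative. *)
Lemma landau_inequality (R : realType) (V : normedModType R) (f : V -> R)
    (x v : V) (t B0 B2 : R) : 0 < t ->
  (forall s, `|s| <= t -> derivable f (x + s *: v) v) ->
  (forall s, `|s| <= t -> derivable ('D_v f) (x + s *: v) v) ->
  `|f x| <= B0 -> `|f (x + t *: v)| <= B0 ->
  (forall s, `|s| <= t -> `|'D_v ('D_v f) (x + s *: v)| <= B2) ->
  `|'D_v f x| <= 2 * B0 / t + t * B2.
Proof.
move=> t0 df ddf fx fxt DD.
have tE : `|t| = t by rewrite gtr0_norm.
have [|s st Es] := @MVT_line R V f x v t.
  by move=> s; rewrite tE; exact: df.
rewrite tE in st.
have [|s' s's Es'] := @MVT_line R V ('D_v f) x v s.
  by move=> s' s's; apply: ddf; exact: le_trans st.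
have DsE : `|'D_v f (x + s *: v)| <= 2 * B0 / t.
  rewrite ler_pdivlMr // -[X in _ * X]tE -normrM mulrC -Es mulr2n mulrDl !mul1r.
  by apply: le_trans (ler_normB _ _) _; rewrite lerD.
have -> : 'D_v f x = 'D_v f (x + s *: v) - s * 'D_v ('D_v f) (x + s' *: v).
  by rewrite -Es' subKr.
apply: le_trans (ler_normB _ _) (lerD DsE _).
by rewrite normrM ler_pM // DD // (le_trans s's).
Qed.

Lemma locO_derive (R : realType) n (D : set 'rV[R]_n)
    (F : Ieps R -> 'rV[R]_n -> R) (i : 'I_n) :
  open D -> (forall eps, smooth_on D (F eps)) ->
  (forall x, D x -> exists N : nat,
    locO x (fun eps => 'D_('e_i) ('D_('e_i) (F eps))) (fun e => e ^- N)) ->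
  (forall x (m : nat), D x -> locO x F (fun e => e ^+ m)) ->
  forall x (m : nat), D x ->
    locO x (fun eps => 'D_('e_i) (F eps)) (fun e => e ^+ m).
Proof.
move=> oD sF modF negF x m Dx.
have [N [V2 xV2 [C2 [eta2 [eta20 H2]]]]] := modF x Dx.
have [V0 xV0 [C0 [eta0 [eta00 H0]]]] := negF x (m + (m + N))%N Dx.
have : nbhs x (D `&` V0 `&` V2).
  by do 2 apply: filterI => //; exact: open_nbhs_nbhs.
case/nbhs_ballP => d /= d0 dP.
pose r := Num.min (d / 2) 1.
have r0 : 0 < r by rewrite lt_min ltr01 divr_gt0.
exists (ball x (d / 2)); first by apply: nbhsx_ballx; rewrite divr_gt0.
exists (2 * C0 / r + r * C2), (Num.min eta0 eta2).
split; first by rewrite lt_min eta00.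
move=> eps; rewrite lt_min => /andP[/H0{}H0 /H2{}H2] y xy.
have /andP[e0 e1] := valP eps; set e := val eps in e0 e1 H0 H2 *.
(* The factor [r <= 1] keeps the segment of length [t] in the ball. *)
pose t := r * e ^+ (m + N).
have t0 : 0 < t by rewrite mulr_gt0 // exprn_gt0.
have inD s : `|s| <= t -> (D `&` V0 `&` V2) (y + s *: 'e_i).
  move=> st; apply: dP; rewrite -ball_normE /ball_ /= opprD addrA.
  apply: le_lt_trans (ler_normB _ _) _; rewrite [d]splitr; apply: ltr_leD.
    by move: xy; rewrite -ball_normE.
  have sr : `|s| <= d / 2.
    apply: le_trans st _; apply: (@le_trans _ _ r); last by rewrite ge_min lexx.
    by rewrite ler_piMr ?(ltW r0) // exprn_ile1 // ltW.
  apply: rV_norm_le => [|j]; first by rewrite divr_ge0 // ltW.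
  rewrite !mxE eqxx /=; case: eqP => _; rewrite ?mulr1 // mulr0 normr0.
  by rewrite divr_ge0 // ltW.
have y0 : y = y + 0 *: 'e_i by rewrite scale0r addr0.
have tt : `|t| <= t by rewrite gtr0_norm.
have t00 : `|0 : R| <= t by rewrite normr0 ltW.
have -> : (2 * C0 / r + r * C2) * e ^+ m =
    2 * (C0 * e ^+ (m + (m + N))) / t + t * (C2 * e ^- N).
  rewrite /t !exprD; field.
  by rewrite !expf_neq0 ?(lt0r_neq0 e0) ?(lt0r_neq0 r0).
apply: landau_inequality => //.
- by move=> s /inD[[Ds _] _]; exact: smooth_on_derivable (sF eps) Ds.
- move=> s /inD[[Ds _] _].
  exact: smooth_on_derivable (smooth_on_derive i (sF eps)) Ds.
- by apply: H0; rewrite y0; have [[_ ?] _] := inD 0 t00.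
- by apply: H0; have [[_ ?] _] := inD t tt.
- by move=> s /inD[_]; exact: H2.
Qed.

(** Second derivatives in one and the same direction suffice for each step of
    the induction, so mixed derivatives are not interchanged. *)
Lemma locO_pderivs (R : realType) n (D : set 'rV[R]_n)
    (F : Ieps R -> 'rV[R]_n -> R) :
  open D -> (forall eps, smooth_on D (F eps)) ->
  (forall s x, D x -> exists N : nat,
    locO x (fun eps => pderivs s (F eps)) (fun e => e ^- N)) ->
  (forall x (m : nat), D x -> locO x F (fun e => e ^+ m)) ->
  forall s x (m : nat), D x ->
    locO x (fun eps => pderivs s (F eps)) (fun e => e ^+ m).
Proof.
move=> oD sF modF negF; elim=> [//|i s IH] x m Dx.
apply: (@locO_derive R n D (fun eps => pderivs s (F eps)) i) => // [eps|y Dy].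
  exact: smooth_on_pderivs.
exact: (modF [:: i, i & s]).
Qed.

(** * Real and imaginary parts of scalars *)

Section ScalarParts.
Variables (R : realType) (k : scalar_field).
Implicit Types (z w : Kfield R k) (a b : R).

(** With this factor the formula [imK (mkK k a b) = im_factor * b] holds for
    both scalar fields. *)
Definition im_factor : R := if k is RealField then 0 else 1.

Lemma reK_mkK a b : reK (mkK k a b) = a.
Proof. by case: k. Qed.

Lemma imK_mkK a b : imK (mkK k a b) = im_factor * b.
Proof. by rewrite /im_factor; case: k => /=; rewrite ?mul0r ?mul1r. Qed.

Lemma mkK_scale a b c : mkK k a 0 * mkK k b c = mkK k (a * b) (a * c).
Proof.
case: k => //=; rewrite [LHS]/GRing.mul /= ; congr complex.Complex.
  by rewrite mul0r subr0.
by rewrite mul0r addr0.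
Qed.

Lemma reK_le_absK z : `|reK z| <= absK z.
Proof.
case: k z => //= -[a b]; rewrite /absK /= -sqrtr_sqr.
by rewrite ler_sqrt ?addr_ge0 ?sqr_ge0 // lerDl sqr_ge0.
Qed.

Lemma imK_le_absK z : `|imK z| <= absK z.
Proof.
case: k z => /= [z|[a b]]; first by rewrite normr0; exact: normr_ge0.
rewrite /absK /= -sqrtr_sqr.
by rewrite ler_sqrt ?addr_ge0 ?sqr_ge0 // lerDr sqr_ge0.
Qed.

Lemma absK_le z : absK z <= `|reK z| + `|imK z|.
Proof.
case: k z => /= [z|[a b]]; first by rewrite normr0 addr0.
rewrite /absK /= -(@ler_pXn2r _ 2) ?nnegrE ?sqrtr_ge0 ?addr_ge0 //.
rewrite sqr_sqrtr ?addr_ge0 ?sqr_ge0 // sqrrD !real_normK ?num_real //.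
by rewrite lerD2r lerDl mulrn_wge0 ?mulr_ge0.
Qed.

Lemma absKM z w : absK (z * w) = absK z * absK w.
Proof.
rewrite /absK normrM; case: k z w => //= z w.
by rewrite mul0r subr0.
Qed.

Lemma absKD z w : absK (z + w) <= absK z + absK w.
Proof. by have := absKB z (- w); rewrite opprK {3}/absK normrN. Qed.

Lemma absK_sum (I : Type) (r : seq I) (F : I -> Kfield R k) :
  absK (\sum_(i <- r) F i) <= \sum_(i <- r) absK (F i).
Proof.
elim/big_rec2: _ => [|i y z _ H]; first by rewrite absK0.
by apply: le_trans (absKD _ _) _; rewrite lerD2l.
Qed.
End ScalarParts.

(** * Balls and charts *)

Section Balls.
Variables (R : realType) (n : nat).
Implicit Types (x y : 'rV[R]_n) (r : R).

Definition cball x r : set 'rV[R]_n := [set y | `|y - x| <= r].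

Lemma compact_cball x r : compact (cball x r).
Proof.
apply: bounded_closed_compact.
  exists (`|x| + r); split; first exact: num_real.
  move=> M xrM y /= yx; apply: ltW; apply: le_lt_trans xrM.
  by rewrite -lerBlDl; apply: le_trans yx; exact: lerB_dist.
rewrite (_ : cball x r = (fun y => `|y - x|) @^-1` [set t | t <= r]) //.
apply: closed_comp; last exact: closed_le.
move=> y _; apply: continuous_comp; last exact: norm_continuous.
by apply: continuousB; [exact: cvg_id|exact: cst_continuous].
Qed.

Lemma nbhs_cball x r : 0 < r -> nbhs x (cball x r).
Proof.
move=> r0; apply/nbhs_ballP; exists r => // y.
by rewrite -ball_normE /ball_ /= /cball /= distrC => /ltW.
Qed.

Lemma nbhs_cball_sub x (V : set 'rV[R]_n) :
  nbhs x V -> exists2 r, 0 < r & cball x r `<=` V.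
Proof.
case/nbhs_ballP => d /= d0 dV; exists (d / 2); first by rewrite divr_gt0.
move=> y; rewrite /cball /= => yx.
apply: dV; rewrite -ball_normE /ball_ /= distrC.
by apply: le_lt_trans yx _; rewrite ltr_pdivrMr // ltr_pMr // ltr1n.
Qed.

End Balls.

Section Charts.
Variables (R : realType) (n : nat) (X : topologicalType).
Implicit Types (c : chart R n X) (p q : X).

Lemma open_chart_image c W : open W -> W `<=` chart_dom c -> open (c @` W).
Proof.
move=> oW Wc; rewrite openE => x [p Wp <-{x}].
have ip : (c @` chart_dom c) (c p) by exists p => //; exact: Wc.
have : nbhs (c p) (chart_img c `&` chart_inv c @^-1` W).
  apply: filterI.
    by apply: open_nbhs_nbhs; split=> //; exact: chart_open_img.
  apply: (chart_inv_cont ip); rewrite chart_mapK; last exact: Wc.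
  exact: open_nbhs_nbhs.
apply: filterS => y [[q cq <-]] /=; rewrite chart_mapK // => Wq.
by exists q.
Qed.

Lemma chart_img_inv c x : chart_img c x -> chart_dom c (chart_inv c x).
Proof. by case=> p cp <-; rewrite chart_mapK. Qed.

Lemma chart_invK c x : chart_img c x -> c (chart_inv c x) = x.
Proof. by case=> p cp <-; rewrite chart_mapK. Qed.

Lemma chart_img_map c p : chart_dom c p -> chart_img c (c p).
Proof. by move=> cp; exists p. Qed.

Lemma chart_inv_compact c (B : set 'rV[R]_n) :
  compact B -> B `<=` chart_img c -> compact (chart_inv c @` B).
Proof.
move=> cB Bc; apply: continuous_compact => //.
by apply: continuous_in_subspaceT => x /[1!inE] /Bc; exact: chart_inv_cont.
Qed.

Lemma nbhs_chart_preimage c p (V : set 'rV[R]_n) : chart_dom c p ->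
  nbhs (c p) V -> nbhs p (chart_dom c `&` c @^-1` V).
Proof.
move=> cp cV; apply: filterI.
  by apply: open_nbhs_nbhs; split=> //; exact: chart_open_dom.
exact: (chart_map_cont cp).
Qed.

Variable A : smooth_atlas R n X.

Lemma smooth_on_transition c c' (g : 'rV[R]_n -> R) :
  charts A c -> charts A c' -> smooth_on (chart_img c) g ->
  smooth_on (c' @` (chart_dom c' `&` chart_dom c)) (g \o (c \o chart_inv c')).
Proof.
move=> Ac Ac' sg; have oc : open (chart_img c) by exact: chart_open_img.
apply: (smooth_on_comp (E := chart_img c)) => //.
- apply: open_chart_image; last by move=> ? [].
  by apply: openI; exact: chart_open_dom.
- by move=> _ [p [c'p cp] <-] /=; rewrite chart_mapK //; exact: chart_img_map.
- exact: (charts_compat Ac' Ac).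
Qed.

End Charts.

Lemma compact_nbhs_chart (R : realType) n (X : topologicalType)
    (A : smooth_atlas R n X) (p : X) : exists2 K, nbhs p K & compact K.
Proof.
have [c Ac cp] := charts_cover A p.
have cip : chart_img c (c p) by exact: chart_img_map.
have oc : open (chart_img c) by exact: chart_open_img.
have [r r0 rc] := nbhs_cball_sub (open_nbhs_nbhs (conj oc cip)).
exists (chart_inv c @` cball (c p) r); last first.
  by apply: chart_inv_compact => //; exact: compact_cball.
apply: filterS (nbhs_chart_preimage cp (nbhs_cball (c p) r0)) => q [cq rq].
by exists (c q) => //; rewrite chart_mapK.
Qed.

(** * Chart derivatives as global differential operators *)

Section CutoffOperator.
Variables (R : realType) (n : nat) (X : topologicalType).
Variables (A : smooth_atlas R n X) (k : scalar_field).
Hypothesis hX : hausdorff_space X.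
Variables (c : chart R n X) (Ac : charts A c).
Variables (chi : 'rV[R]_n -> R) (B : set 'rV[R]_n).
Hypothesis chi_smooth : smooth_on (chart_img c) chi.
Hypothesis compactB : compact B.
Hypothesis subB : B `<=` chart_img c.
Hypothesis chi_supp : forall x, ~ B x -> chi x = 0.
Variable s : seq 'I_n.

(** The chart derivative along the word [s], multiplied by a function [chi]
    with compact support in the chart and extended by 0. *)
Definition cutoff_fun (u : X -> Kfield R k) (p : X) : Kfield R k :=
  if `[< chart_dom c p >] then
    mkK k (chi (c p)) 0 * pderivsK s (u \o chart_inv c) (c p)
  else 0.

Let S := chart_inv c @` B.

(** Closedness rests on the Hausdorff axiom; without it the extension by 0
    could be discontinuous at boundary points of the chart domain. *)
Lemma closed_cutoff_supp : closed S.
Proof. by apply: compact_closed => //; exact: chart_inv_compact. Qed.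

Lemma cutoff_fun_out u p : ~ S p -> cutoff_fun u p = 0.
Proof.
rewrite /cutoff_fun; case: asboolP => // cp Sp.
suff -> : chi (c p) = 0 by rewrite (_ : mkK k 0 0 = 0) ?mul0r //; case: (k).
by apply: chi_supp => Bcp; apply: Sp; exists (c p) => //; rewrite chart_mapK.
Qed.

(** The two open sets on which smoothness is checked are the chart domain,
    where it is a matter of transition maps, and the complement of the closed
    set [S], where the function is 0. *)
Lemma cutoff_real_smooth (v : 'rV[R]_n -> R) (F : X -> R) :
  smooth_on (chart_img c) v ->
  (forall p, chart_dom c p -> F p = chi (c p) * v (c p)) ->
  (forall p, ~ S p -> F p = 0) ->
  forall c', charts A c' -> smooth_on (chart_img c') (F \o chart_inv c').
Proof.
move=> sv Fin Fout c' Ac'.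
have oc : open (chart_img c) by exact: chart_open_img.
have oc' : open (chart_dom c') by exact: chart_open_dom.
apply: smooth_on_local => _ [p c'p <-].
have [cp|cp] := pselect (chart_dom c p).
  exists (c' @` (chart_dom c' `&` chart_dom c)); last by exists p.
  have oW : open (c' @` (chart_dom c' `&` chart_dom c)).
    apply: open_chart_image; last by move=> ? [].
    by apply: openI => //; exact: chart_open_dom.
  apply: (smooth_on_ext oW _
    (smooth_on_transition Ac Ac' (smooth_onM oc chi_smooth sv))).
  by move=> _ [q [c'q cq] <-] /=; rewrite chart_mapK // Fin.
exists (c' @` (chart_dom c' `&` ~` S)); last first.
  exists p => //; split=> // -[x Bx Ex]; apply: cp; rewrite -Ex.
  by apply: chart_img_inv; exact: subB.
have oW : open (c' @` (chart_dom c' `&` ~` S)).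
  apply: open_chart_image; last by move=> ? [].
  by apply: openI => //; apply: closed_openC; exact: closed_cutoff_supp.
apply: (smooth_on_ext oW _ (@smooth_on_cst R n _ 0)) => _ [q [c'q Sq] <-] /=.
by rewrite chart_mapK // Fout.
Qed.

Lemma cutoff_smooth (u : Cinf A k) : cutoff_fun u \in smooth_pred (k := k) A.
Proof.
rewrite inE => c' Ac'.
have := Cinf_smooth u; rewrite inE => /(_ c Ac)[su iu].
split.
  apply: (@cutoff_real_smooth (pderivs s (@reK R k \o (u \o chart_inv c)))
    (@reK R k \o cutoff_fun u)) => //.
  - exact: smooth_on_pderivs.
  - move=> p cp; rewrite /= /cutoff_fun; case: asboolP => // _.
    by rewrite /pderivsK mkK_scale reK_mkK.
  - by move=> p Sp /=; rewrite cutoff_fun_out // reK0.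
apply: (@cutoff_real_smooth
  (cst (im_factor R k) * pderivs s (@imK R k \o (u \o chart_inv c)))
  (@imK R k \o cutoff_fun u)) => //.
- apply: smooth_onM; first exact: chart_open_img.
    exact: smooth_on_cst.
  exact: smooth_on_pderivs.
- move=> p cp; rewrite /= /cutoff_fun; case: asboolP => // _.
  by rewrite /pderivsK mkK_scale imK_mkK !fctE mulrCA.
- by move=> p Sp /=; rewrite cutoff_fun_out // imK0.
Qed.

Definition cutoff_op (u : Cinf A k) : Cinf A k := MkCinf (cutoff_smooth u).

Lemma diffop_cutoff : diffop cutoff_op.
Proof.
exists (size s) => p; have [cp|cp] := pselect (chart_dom c p).
  exists c, (chart_dom c).
  exists (fun s' x => if s' == s then mkK k (chi x) 0 else 0).
  split=> //; first exact: chart_open_dom.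
  split=> [s'|u q cq].
    have [_|_] := eqVneq s' s; last first.
      by split; rewrite (_ : _ \o _ = cst 0); do ?[exact: smooth_on_cst];
        apply/funext => x /=; rewrite ?reK0 ?imK0.
    split.
      by rewrite (_ : _ \o _ = chi) //; apply/funext => x /=; rewrite reK_mkK.
    rewrite (_ : _ \o _ = cst 0); first exact: smooth_on_cst.
    by apply/funext => x /=; rewrite imK_mkK mulr0.
  rewrite /= /cutoff_fun asboolT //.
  rewrite (bigD1 ord_max) //= (bigD1 (in_tuple s)) //= eqxx.
  rewrite big1 => [|t ts]; last first.
    by rewrite -val_eqE /= in ts; rewrite (negbTE ts) mul0r.
  rewrite addr0 big1 ?addr0 // => j js; apply: big1 => t _.
  case: eqP => [ts|_]; last by rewrite mul0r.
  move: js; rewrite -val_eqE /= => /negP[]; apply/eqP.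
  by rewrite -[LHS](size_tuple t) ts.
have [c' Ac' c'p] := charts_cover A p.
exists c', (chart_dom c' `&` ~` S), (fun _ _ => 0); split => //.
- apply: openI; first exact: chart_open_dom.
  by apply: closed_openC; exact: closed_cutoff_supp.
- split=> // -[x Bx Ex]; apply: cp; rewrite -Ex.
  by apply: chart_img_inv; exact: subB.
split=> [s'|u q [c'q Sq]].
  by split; rewrite (_ : _ \o _ = cst 0); do ?[exact: smooth_on_cst];
    apply/funext => x /=; rewrite ?reK0 ?imK0.
rewrite /= cutoff_fun_out // big1 // => j _; apply: big1 => t _.
by rewrite mul0r.
Qed.

End CutoffOperator.

(** * Negligibility is decided by the estimate of order zero *)

Section Negligibility.
Variables (R : realType) (n : nat) (X : topologicalType).
Variables (A : smooth_atlas R n X) (k : scalar_field).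
Hypothesis hX : hausdorff_space X.
Implicit Types (c : chart R n X).

Lemma pderivs_re_le_absK s (f : 'rV[R]_n -> Kfield R k) y :
  `|pderivs s (@reK R k \o f) y| <= absK (pderivsK s f y).
Proof. by apply: le_trans (reK_le_absK _); rewrite reK_mkK. Qed.

Lemma pderivs_im_le_absK s (f : 'rV[R]_n -> Kfield R k) y :
  `|pderivs s (@imK R k \o f) y| <= absK (pderivsK s f y).
Proof.
apply: le_trans (imK_le_absK _); rewrite imK_mkK /im_factor.
case: k f => f; last by rewrite mul1r.
rewrite mul0r (_ : _ \o f = cst 0) // pderivs_cst.
by case: s; rewrite normr0.
Qed.

Lemma absK_pderivsK_le s (f : 'rV[R]_n -> Kfield R k) y :
  absK (pderivsK s f y) <=
  `|pderivs s (@reK R k \o f) y| + `|pderivs s (@imK R k \o f) y|.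
Proof.
apply: le_trans (absK_le _) _; rewrite reK_mkK imK_mkK lerD2l normrM.
by rewrite ler_piMl // /im_factor; case: (k); rewrite ?normr0 ?normr1.
Qed.

(** The bump at [x] is at least half of its value at [x] on a neighbourhood of
    [x]; there the chart derivative is bounded by a multiple of its cutoff,
    to which moderateness applies. *)
Lemma moderate_locO (u : Ieps R -> Cinf A k) c s x : moderate u -> charts A c ->
  chart_img c x -> exists N : nat,
  locO x (fun eps y => absK (pderivsK s (u eps \o chart_inv c) y))
    (fun e => e ^- N).
Proof.
move=> mu Ac cx.
have oc : open (chart_img c) by exact: chart_open_img.
have [r r0 rc] := nbhs_cball_sub (open_nbhs_nbhs (conj oc cx)).
have chi_supp y : ~ cball x r y -> bump x r y = 0.
  by move=> /negP; rewrite /cball /= -ltNge => /(bump_eq0 r0).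
pose P : Cinf A k -> Cinf A k := cutoff_op hX Ac (smooth_on_bump x r oc)
  (@compact_cball R n x r) rc chi_supp s.
have cL : compact (chart_inv c @` cball x r).
  by apply: chart_inv_compact => //; exact: compact_cball.
have [N [C [eta [eta0 H]]]] := mu _ P cL (diffop_cutoff _ _ _ _ _ _ _ _).
have b0 : 0 < bump x r x by apply: bump_gt0 => //; rewrite subrr normr0.
have cb : {for x, continuous (bump x r)}.
  exact: smooth_on_continuous (smooth_on_bump x r oc) cx.
exists N; exists (cball x r `&` [set y | bump x r x / 2 <= bump x r y]).
  apply: filterI; first exact: nbhs_cball.
  have h0 : 0 < bump x r x / 2 by rewrite divr_gt0.
  apply: filterS ((cvgrPdist_le _ _).1 cb _ h0) => y /=.
  move=> /(le_trans (ler_norm _)); rewrite lerBlDr -lerBlDl.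
  by rewrite [X in X - _]splitr addrK.
exists (2 / bump x r x * C), eta; split=> // eps /H{}H y [ry by_].
rewrite ger0_norm ?absK_ge0 //.
have cy : chart_img c y := rc y ry.
have : ((absK (P (u eps) (chart_inv c y)))%:E <= (C * val eps ^- N)%:E)%E.
  by apply: le_trans H; apply: ereal_sup_ubound; exists (chart_inv c y).
rewrite lee_fin /P /= /cutoff_fun asboolT; last exact: chart_img_inv.
rewrite chart_invK // absKM => PC.
rewrite -[leRHS]mulrA -invf_div mulrC ler_pdivlMr ?divr_gt0 //.
apply: le_trans PC; rewrite mulrC; apply: ler_wpM2r; first exact: absK_ge0.
apply: le_trans (reK_le_absK _); rewrite reK_mkK.
by apply: le_trans by_ _; exact: ler_norm.
Qed.

Lemma negligible_of_locO (u : Ieps R -> Cinf A k) : moderate u ->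
  (forall p (m : nat),
     locO p (fun eps q => absK (u eps q)) (fun e => e ^+ m)) ->
  negligible_net u.
Proof.
move=> mu nu L P m cL [r dP].
have deriv c (f : Ieps R -> 'rV[R]_n -> R) : charts A c ->
    (forall eps, smooth_on (chart_img c) (f eps)) ->
    (forall s eps y, `|pderivs s (f eps) y| <=
       absK (pderivsK s (u eps \o chart_inv c) y)) ->
    forall s x, chart_img c x ->
    locO x (fun eps => pderivs s (f eps)) (fun e => e ^+ m).
  move=> Ac sf f_le s x cx.
  apply: (@locO_pderivs R n (chart_img c) f) => //; first exact: chart_open_img.
    move=> s' y cy; have [N HN] := moderate_locO s' mu Ac cy; exists N.
    apply: locO_leT HN => eps z.
    by rewrite [leRHS]ger0_norm ?absK_ge0.
  move=> y m' cy; have cinv := chart_inv_cont cy.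
  apply: locO_leT (locO_comp cinv (nu (chart_inv c y) m')) => eps z.
  rewrite [leRHS]ger0_norm ?absK_ge0 //.
  by apply: le_trans (f_le [::] eps z) _; rewrite /pderivsK /= mkKK.
pose re c eps := @reK R k \o (u eps \o chart_inv c).
pose im c eps := @imK R k \o (u eps \o chart_inv c).
have su c eps : charts A c ->
    smooth_on (chart_img c) (re c eps) /\ smooth_on (chart_img c) (im c eps).
  by move=> Ac; have := Cinf_smooth (u eps); rewrite inE => /(_ c Ac).
have Re c s x : charts A c -> chart_img c x ->
    locO x (fun eps => pderivs s (re c eps)) (fun e => e ^+ m).
  move=> Ac; apply: deriv => // [eps|s' eps y]; first exact: (su c eps Ac).1.
  exact: pderivs_re_le_absK.
have Im c s x : charts A c -> chart_img c x ->
    locO x (fun eps => pderivs s (im c eps)) (fun e => e ^+ m).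
  move=> Ac; apply: deriv => // [eps|s' eps y]; first exact: (su c eps Ac).2.
  exact: pderivs_im_le_absK.
have loc p : locO p (fun eps q => absK (P (u eps) q)) (fun e => e ^+ m).
  have [c [W [a [Ac oW Wp Wc [sa PE]]]]] := dP p.
  have cp : chart_dom c p by exact: Wc.
  have cWp : (c @` W) (c p) by exists p.
  have ccp : chart_img c (c p) by exists p.
  pose T s eps y := (`|reK (a s y)| + `|imK (a s y)|) *
    (`|pderivs s (re c eps) y| + `|pderivs s (im c eps) y|).
  have OT s : locO (c p) (T s) (fun e => e ^+ m).
    apply: locO_mull; last first.
      apply: locOD.
        apply: locO_leT (Re c s _ Ac ccp) => eps y.
        by rewrite normr_id.
      by apply: locO_leT (Im c s _ Ac ccp) => eps y; rewrite normr_id.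
    have [sr si] := sa s.
    apply: (@continuousD _ _ _ (fun y => `|reK (a s y)|)
      (fun y => `|imK (a s y)|)).
      apply: (@continuous_comp _ _ _ (@reK R k \o a s) Num.norm).
        exact: smooth_on_continuous sr cWp.
      exact: norm_continuous.
    apply: (@continuous_comp _ _ _ (@imK R k \o a s) Num.norm).
      exact: smooth_on_continuous si cWp.
    exact: norm_continuous.
  have OS := locO_sum (index_enum 'I_r.+1) (fun j =>
    locO_sum (index_enum (j.-tuple 'I_n)) (fun s => OT (val s))).
  apply: locO_le (locO_comp (chart_map_cont cp) OS).
  apply: filterS (open_nbhs_nbhs (conj oW Wp)) => q Wq eps.
  rewrite ger0_norm ?absK_ge0 // PE //.
  apply: le_trans (ler_norm _); apply: le_trans (absK_sum _ _) _.
  apply: ler_sum => j _; apply: le_trans (absK_sum _ _) _.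
  apply: ler_sum => s _; rewrite absKM; apply: ler_pM; rewrite ?absK_ge0 //.
    exact: absK_le.
  exact: absK_pderivsK_le.
have e0 (e : R) : 0 < e -> 0 <= e ^+ m by move=> e0; rewrite exprn_ge0 // ltW.
have [C [eta [eta0 H]]] := compact_locO e0 cL (fun p _ => loc p).
exists C, eta; split=> // eps /H{}H; apply: ge_ereal_sup => _ [p Lp <-].
by rewrite lee_fin; apply: le_trans (H p Lp); exact: ler_norm.
Qed.

End Negligibility.

(** * Lower bounds for the Riemannian distance *)

Section QuadraticForms.
Variables (R : realType) (n : nat).
Implicit Types (G : 'M[R]_n) (v : 'rV[R]_n).

Definition quad G v : R := (v *m G *m v^T) 0 0.

Lemma quadE G v : quad G v = \sum_j (\sum_i v 0 i * G i j) * v 0 j.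
Proof. by rewrite /quad mxE; apply: eq_bigr => j _; rewrite !mxE. Qed.

Lemma quadZ G a v : quad G (a *: v) = a ^+ 2 * quad G v.
Proof.
by rewrite /quad linearZ /= -scalemxAl -scalemxAl -scalemxAr !mxE mulrA expr2.
Qed.

Lemma continuous_quad G : continuous (quad G).
Proof.
have -> : quad G = fun v => \sum_j (\sum_i v 0 i * G i j) * v 0 j.
  by apply/funext => v; exact: quadE.
apply: continuous_big => [|j _]; first exact: add_continuous.
move=> v; apply: (@continuousM _ _ (fun v => \sum_i v 0 i * G i j)
  (fun v : 'rV[R]_n => v 0 j)); last exact: coord_continuous.
move: v; apply: continuous_big => [|i _]; first exact: add_continuous.
move=> v; apply: (@continuousM _ _ (fun v : 'rV[R]_n => v 0 i) (cst (G i j))).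
  exact: coord_continuous.
exact: cst_continuous.
Qed.

Lemma quad_perturb G (H : 'M[R]_n) v (d : R) : `|v| <= 1 ->
  (forall i j, `|G i j - H i j| <= d) ->
  `|quad G v - quad H v| <= (n * n)%:R * d.
Proof.
move=> v1 GH.
have vi i : `|v 0 i| <= 1 by exact: le_trans (coord_le_norm v i) v1.
rewrite !quadE -sumrB; apply: le_trans (ler_norm_sum _ _ _) _.
apply: (@le_trans _ _ (\sum_(j < n) \sum_(i < n) d)); last first.
  by rewrite !sumr_const !card_ord -mulrnA mulr_natl.
apply: ler_sum => j _; rewrite -mulrBl -sumrB normrM.
have S0 : \sum_i `|v 0 i * G i j - v 0 i * H i j| <= \sum_(i < n) d.
  apply: ler_sum => i _; rewrite -mulrBr normrM.
  by rewrite -[leRHS]mul1r ler_pM.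
apply: le_trans S0; rewrite -[leRHS]mulr1 ler_pM //.
exact: ler_norm_sum.
Qed.

(** The minimum [m] of the form over the compact unit sphere at [x] is
    positive, and by [quad_perturb] it stays above [m / 2] nearby. *)
Lemma quad_lower_near (T : topologicalType) (G : T -> 'M[R]_n) (x : T) :
  (forall i j, {for x, continuous (fun y => G y i j)}) ->
  (forall v, v != 0 -> 0 < quad (G x) v) ->
  exists2 kap : R, 0 < kap &
    \forall y \near x, forall v, kap * `|v| <= Num.sqrt (quad (G y) v).
Proof.
move=> cG posG.
pose S : set 'rV[R]_n := [set v | `|v| = 1].
have cS : compact S.
  apply: (@subclosed_compact _ _ (cball 0 1)); [|exact: compact_cball|].
    rewrite (_ : S = Num.norm @^-1` [set (1 : R)]) //.
    apply: closed_comp; last exact: closed_eq.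
    by move=> y _; exact: norm_continuous.
  by move=> v; rewrite /S /cball /= subr0 => ->.
have [m m0 mS] : exists2 m : R, 0 < m & forall v, S v -> m <= quad (G x) v.
  have [S0|S0] := pselect (S !=set0); last first.
    by exists 1 => // v Sv; exfalso; apply: S0; exists v.
  have [v] := EVT_min_rV S0 cS (continuous_subspaceT (@continuous_quad (G x))).
  rewrite inE => Sv minv; exists (quad (G x) v); last first.
    by move=> w Sw; apply: minv; rewrite inE.
  by apply: posG; rewrite -normr_eq0 Sv oner_neq0.
pose d := m / 2 / (n * n).+1%:R.
have d0 : 0 < d by rewrite !divr_gt0.
exists (Num.sqrt (m / 2)); first by rewrite sqrtr_gt0 divr_gt0.
have near_ij i j : \forall y \near x, `|G x i j - G y i j| <= d.
  exact: (cvgrPdist_le _ _).1 (cG i j) _ d0.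
have near_i i : \forall y \near x, forall j, `|G x i j - G y i j| <= d.
  exact: (@filter_forall _ 'I_n (fun j y => `|G x i j - G y i j| <= d)
    (nbhs x) _ (near_ij i)).
have near_all : \forall y \near x, forall i j, `|G x i j - G y i j| <= d.
  exact: (@filter_forall _ 'I_n (fun i y => forall j, `|G x i j - G y i j| <= d)
    (nbhs x) _ near_i).
apply: filterS near_all => y Gy v.
have [->|v0] := eqVneq v 0; first by rewrite normr0 mulr0 sqrtr_ge0.
pose w := `|v|^-1 *: v.
have nv : 0 < `|v| by rewrite normr_gt0.
have Sw : S w by rewrite /S /= normrZ normfV normr_id mulVf // gt_eqF.
have qw : m / 2 <= quad (G y) w.
  have w1 : `|w| <= 1 by rewrite Sw.
  have := quad_perturb w1 Gy.
  rewrite ler_norml => /andP[_].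
  rewrite lerBlDr -lerBlDl => H; apply: le_trans H; rewrite lerBrDr.
  apply: le_trans (mS w Sw); rewrite [leRHS]splitr lerD2l /d.
  rewrite mulrCA ger_pMr ?divr_gt0 // ler_pdivrMr ?ltr0n // mul1r ler_nat.
  exact: leqnSn.
have -> : v = `|v| *: w by rewrite /w scalerA mulfV ?scale1r // gt_eqF.
rewrite quadZ [leRHS]sqrtrM ?sqr_ge0 // sqrtr_sqr normrZ Sw mulr1.
rewrite normr_id mulrC.
by rewrite ler_wpM2l // ler_wsqrtr.
Qed.

End QuadraticForms.

Lemma differentiable_rV (R : realType) n (V : normedModType R)
    (f : V -> 'rV[R]_n) (x : V) :
  (forall j, differentiable (fun y => f y 0 j) x) -> differentiable f x.
Proof.
move=> df; rewrite (_ : f = \sum_(j < n) (fun y => f y 0 j *: 'e_j)).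
  apply: differentiable_sum => j; exact: differentiableZl.
apply/funext => y; rewrite [LHS]row_sum_delta.
by rewrite fct_sumE.
Qed.

Lemma smooth_on_differentiable_rV (R : realType) m n (D : set 'rV[R]_m)
    (f : 'rV[R]_m -> 'rV[R]_n) x : open D ->
  (forall j, smooth_on D (fun y => f y 0 j)) -> D x -> differentiable f x.
Proof.
move=> oD sf Dx; apply: differentiable_rV => j.
exact: smooth_on_differentiable oD (sf j) Dx.
Qed.

Section Speed.
Variables (R : realType) (n : nat) (X : topologicalType).
Variables (A : smooth_atlas R n X) (h : riemannian_metric A).

(** The speed is defined with a chart chosen at each point of the curve; by
    compatibility of the Gram matrices any chart of the atlas gives the same
    value, so one chart can serve along a whole arc. *)
Lemma speed_chart (gam : R -> X) t c : charts A c -> chart_dom c (gam t) ->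
  {for t, continuous gam} -> derivable (c \o gam) t 1 ->
  speed h gam t = Num.sqrt (quad (gram h c (c (gam t))) (derive1 (c \o gam) t)).
Proof.
move=> Ac ct cgam dc; rewrite /speed.
have [Ac' c't] : charts A (chart_at A (gam t)) /\
    chart_dom (chart_at A (gam t)) (gam t).
  by rewrite /chart_at; case: cid2.
set c' := chart_at A (gam t) in Ac' c't *.
pose tau := c' \o chart_inv c.
have oD : open (c @` (chart_dom c `&` chart_dom c')).
  apply: open_chart_image; last by move=> ? [].
  by apply: openI; exact: chart_open_dom.
have dtau : differentiable tau (c (gam t)).
  apply: (smooth_on_differentiable_rV oD); first exact: (charts_compat Ac Ac').
  by exists (gam t).
have E : derive1 (c' \o gam) t = derive1 (c \o gam) t *m 'J tau (c (gam t)).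
  rewrite !derive1E -deriveEjacobian // [RHS]deriveE //.
  have [_ <-] := chain_direction dc dtau.
  apply: near_eq_derive.
  have : \forall s \near t, chart_dom c (gam s).
    apply: cgam; apply: open_nbhs_nbhs; split => //; exact: chart_open_dom.
  by apply: filterS => s cs; rewrite /tau /= chart_mapK.
rewrite E (gram_compat h Ac Ac' ct c't) /quad trmx_mul.
by rewrite !mulmxA.
Qed.

End Speed.

Section Lengths.
Variable R : realType.
Local Notation mu := (@lebesgue_measure R).

(** The integral of a nonnegative function is a supremum over simple functions
    below it, hence monotone without measurability; in this way the speed of
    a curve need not be shown measurable. *)
Lemma ge0_le_integral_nonmeasurable d (T : measurableType d)
    (m : {measure set T -> \bar R}) (D E : set T) (f g : T -> \bar R) :
  (forall x, D x -> 0 <= f x)%E -> (forall x, E x -> 0 <= g x)%E ->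
  D `<=` E -> (forall x, D x -> f x <= g x)%E ->
  (\int[m]_(x in D) f x <= \int[m]_(x in E) g x)%E.
Proof.
move=> f0 g0 DE fg; rewrite !ge0_integralE //.
apply: le_ereal_sup => _ [s /= sf <-].
exists s => // x; apply: le_trans (sf x) _.
rewrite !patchE; case: ifPn => [xD|_].
  by rewrite ifT ?inE; [apply: fg; rewrite -inE|apply: DE; rewrite -inE].
by case: ifPn => // /[1!inE] /g0.
Qed.

(** The fundamental theorem of calculus on [0, T] for [w] multiplied by the sign
    of its total increment. *)
Lemma displacement_le_integral (w w' sp : R -> R) (T kap : R) :
  0 <= kap -> 0 <= T <= 1 ->
  (forall s, 0 <= s <= T -> is_derive s 1 w (w' s)) ->
  (forall s, 0 <= s <= T -> {for s, continuous w'}) ->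
  (forall s, 0 <= s <= T -> kap * `|w' s| <= sp s) ->
  (forall s, 0 <= sp s) ->
  ((kap * `|w T - w 0|)%:E <= \int[mu]_(t in `[0%R, 1%R]) (sp t)%:E)%E.
Proof.
move=> k0 /andP[T0 T1] dw cw' w'sp sp0.
have int0 : (0 <= \int[mu]_(t in `[0%R, 1%R]) (sp t)%:E)%E.
  by apply: integral_ge0 => t _; rewrite lee_fin.
move: T0; rewrite le_eqVlt => /orP[/eqP <-|T0].
  by rewrite subrr normr0 mulr0.
pose a := kap * Num.sg (w T - w 0).
have aw : a * (w T - w 0) = kap * `|w T - w 0| by rewrite normrEsg /a mulrA.
pose f s := a * w' s; pose F s := a * w s.
have dF s : 0 <= s <= T -> is_derive s 1 F (f s).
  move=> sT; have := dw s sT => dws.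
  have := @is_deriveZ R R R w a s 1 (w' s) dws.
  by apply: near_eq_is_derive; near=> z.
have cF s : 0 <= s <= T -> {for s, continuous F}.
  by move=> /dF[dFs _]; apply/differentiable_continuous/derivable1_diffP.
have cf s : 0 <= s <= T -> {for s, continuous f}.
  move=> sT; apply: (@continuousM _ _ (cst a) w'); last exact: cw'.
  exact: cst_continuous.
have itvT s : s \in `[0, T]%R -> 0 <= s <= T by rewrite in_itv.
have cfT : {within `[0, T], continuous f}.
  by apply: continuous_in_subspaceT => s /[1!inE] /= sT; exact/cf/itvT.
have E : (\int[mu]_(x in `[0%R, T]) (f x)%:E = (F T)%:E - (F 0)%:E)%E.
  apply: continuous_FTC2 => //.
    split.
    - by move=> s /subset_itv_oo_cc /itvT /dF[].
    - by apply: cvg_at_right_filter; apply: cF; rewrite lexx ltW.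
    - by apply: cvg_at_left_filter; apply: cF; rewrite lexx ltW.
  by move=> s /subset_itv_oo_cc /itvT /dF[_]; rewrite derive1E.
have -> : (kap * `|w T - w 0|)%:E = (\int[mu]_(x in `[0%R, T]) (f x)%:E)%E.
  by rewrite E -EFinB /F -mulrBr aw.
apply: le_trans (lee_abs _) _; apply: le_trans (le_abse_integral _ _ _) _ => //.
  apply/measurable_EFinP; exact: subspace_continuous_measurable_fun.
apply: ge0_le_integral_nonmeasurable => [s _|s _|s|s /=]; rewrite ?lee_fin //.
- by rewrite /= !in_itv /= => /andP[-> sT]; apply: le_trans T1.
rewrite in_itv /= => sT; apply: le_trans (w'sp s sT).
rewrite /f /a !normrM (ger0_norm k0) -mulrA ler_wpM2l //.
by rewrite -[leRHS]mul1r ler_wpM2r // normr_sg; case: eqP.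
Unshelve. all: by end_near. Qed.

End Lengths.

Section Confinement.
Variables (R : realType) (n : nat) (X : topologicalType).
Variables (A : smooth_atlas R n X) (h : riemannian_metric A).
Hypothesis hX : hausdorff_space X.
Variables (c : chart R n X) (Ac : charts A c).
Variables (x0 : 'rV[R]_n) (r kap : R).
Hypothesis kap_gt0 : 0 < kap.
Hypothesis ball_sub : cball x0 r `<=` chart_img c.
Hypothesis gram_lower : forall y, cball x0 r y -> forall v,
  kap * `|v| <= Num.sqrt (quad (gram h c y) v).

Lemma speed_ge0 gam t : 0 <= speed h gam t.
Proof. exact: sqrtr_ge0. Qed.

Lemma curve_length_ge0 gam : (0 <= curve_length h gam)%E.
Proof. by apply: integral_ge0 => t _; rewrite lee_fin speed_ge0. Qed.

Lemma curve_displacement gam (T l : R) : C1_curve A gam -> 0 <= T <= 1 ->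
  (forall s, 0 <= s <= T -> chart_dom c (gam s) /\ cball x0 r (c (gam s))) ->
  (curve_length h gam <= l%:E)%E -> kap * `|c (gam T) - c (gam 0)| <= l.
Proof.
move=> Cgam T01 inball len.
have l0 : 0 <= l.
  by rewrite -lee_fin; apply: le_trans len; exact: curve_length_ge0.
rewrite -ler_pdivlMl //; apply: rV_norm_le => [|i].
  by rewrite mulr_ge0 // invr_ge0 ltW.
rewrite ler_pdivlMl // !mxE -lee_fin; apply: le_trans len.
have T01s s : 0 <= s <= T -> 0 <= s <= 1.
  by case/andP: T01 => _ T1 /andP[-> sT]; exact: le_trans T1.
have dc s : 0 <= s <= T -> derivable (c \o gam) s 1 /\
    {for s, continuous (derive1 (c \o gam))}.
  move=> sT; have [_ /(_ c Ac (inball s sT).1)[ds cs]] := Cgam s (T01s s sT).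
  split; last exact: cs.
  exact: (nbhs_singleton (p := s) ds).
apply: (@displacement_le_integral R (fun s => c (gam s) 0 i)
    (fun s => derive1 (c \o gam) s 0 i)) => //; first exact: ltW.
- move=> s /dc[ds _]; split; first by have /derivable_mxP := ds; exact.
  by rewrite derive1E derive_mx // mxE.
- by move=> s /dc[_ cs]; exact: continuous_coord.
- move=> s sT; have [cs bs] := inball s sT.
  rewrite (speed_chart h Ac cs (Cgam s (T01s s sT)).1 (dc s sT).1).
  apply: le_trans (gram_lower bs _); rewrite ler_pM2l //.
  exact: coord_le_norm.
- exact: speed_ge0.
Qed.

(** Until the curve leaves the open ball of radius [r], its chart image stays
    in the closed ball of radius [rho < r] by [curve_displacement].  At the
    first exit time [t0] it would still belong to the preimage of that closed
    ball, which is compact, hence closed in [X], and contained in the open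
    ball: there is no exit. *)
Lemma curve_confined gam (l : R) : C1_curve A gam ->
  chart_dom c (gam 0) -> kap * `|c (gam 0) - x0| + l < kap * r ->
  (curve_length h gam <= l%:E)%E ->
  chart_dom c (gam 1) /\ kap * `|c (gam 1) - c (gam 0)| <= l.
Proof.
move=> Cgam c0 small len.
have l0 : 0 <= l.
  by rewrite -lee_fin; apply: le_trans len; exact: curve_length_ge0.
pose O : set X := chart_dom c `&` c @^-1` [set y | `|y - x0| < r].
pose rho := `|c (gam 0) - x0| + l / kap.
have rhor : rho < r.
  by rewrite -(ltr_pM2l kap_gt0) /rho mulrDr mulrCA mulfV ?mulr1 // gt_eqF.
have oO p : O p -> nbhs p O.
  move=> [cp Op]; apply: nbhs_chart_preimage => //.
  have d0 : 0 < r - `|c p - x0| by rewrite subr_gt0.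
  apply/nbhs_ballP; exists (r - `|c p - x0|) => // y.
  rewrite -ball_normE /ball_ /= ltrBrDl => H.
  by apply: le_lt_trans (ler_distD (c p) _ _) _; rewrite addrC (distrC y).
have O0 : O (gam 0).
  split=> //=; apply: le_lt_trans rhor.
  by rewrite /rho lerDl mulr_ge0 // invr_ge0 ltW.
have Oball p : O p -> chart_dom c p /\ cball x0 r (c p).
  by move=> [cp Op]; split=> //; exact: ltW.
have inK T : 0 <= T <= 1 -> (forall s, 0 <= s <= T -> O (gam s)) ->
    kap * `|c (gam T) - c (gam 0)| <= l.
  by move=> T01 sO; apply: curve_displacement len => // s /sO /Oball.
suff allO s : 0 <= s <= 1 -> O (gam s).
  split; first by have [] := allO 1; rewrite ?ler01 ?lexx.
  by apply: inK; rewrite ?ler01 ?lexx.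
apply: contrapT => badex.
pose Bad : set R := [set s | 0 <= s <= 1 /\ ~ O (gam s)].
have Bad0 : Bad !=set0.
  apply: contrapT => /forallNP nB; apply: badex => s01.
  by apply: contrapT => nO; apply: (nB s).
have lbBad : has_lbound Bad by exists 0 => t [/andP[]].
pose t0 := inf Bad.
have t00 : 0 <= t0 by apply: lb_le_inf => // t [/andP[]].
have t01 : t0 <= 1.
  case: Bad0 => t Bt; apply: le_trans (ge_inf lbBad Bt) _.
  by case: Bt => /andP[].
have before t : 0 <= t < t0 -> O (gam t).
  move=> /andP[t_0 tt0]; apply: contrapT => nO.
  have : t0 <= t.
    by apply: ge_inf => //; split=> //; rewrite t_0 (le_trans (ltW tt0)).
  by rewrite leNgt tt0.
have cgt0 : {for t0, continuous gam} by case: (Cgam t0); rewrite ?t00.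
have Ot0 : O (gam t0).
  move: t00; rewrite le_eqVlt => /orP[/eqP <- //|t0_gt0].
  have rho_sub : cball x0 rho `<=` chart_img c.
    by move=> y yr; apply: ball_sub; apply: le_trans yr (ltW rhor).
  pose K := chart_inv c @` cball x0 rho.
  have clK : closed K.
    apply: compact_closed => //; apply: chart_inv_compact => //.
    exact: compact_cball.
  suff [y yr <-] : K (gam t0).
    split; first by apply: chart_img_inv; exact: rho_sub.
    by rewrite /= chart_invK ?(le_lt_trans yr) //; exact: rho_sub.
  apply: contrapT => nK.
  have nbK : nbhs (gam t0) (~` K).
    by apply: open_nbhs_nbhs; split=> //; exact: closed_openC.
  have /nbhs_ballP[d /= d0 dK] := cgt0 _ nbK.
  pose t := Num.max 0 (t0 - d / 2).
  have t_0 : 0 <= t by rewrite le_max lexx.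
  have tt0 : t < t0.
    by rewrite gt_max t0_gt0 ltrBlDr ltrDl divr_gt0.
  have bt : ball t0 d t.
    rewrite -ball_normE /ball_ /= gtr0_norm ?subr_gt0 // ltrBlDr -ltrBlDl.
    rewrite lt_max; apply/orP; right; rewrite ltrD2l ltrN2.
    by rewrite ltr_pdivrMr // ltr_pMr // ltr1n.
  apply: (dK t bt); have Ot : O (gam t) by apply: before; rewrite t_0.
  have t1 : t <= 1 by apply: ltW; exact: lt_le_trans t01.
  have kl : kap * `|c (gam t) - c (gam 0)| <= l.
    apply: inK => [|s' /andP[s0 st]]; first by rewrite t_0.
    by apply: before; rewrite s0 (le_lt_trans st).
  exists (c (gam t)); last by rewrite chart_mapK //; case: Ot.
  apply: le_trans (ler_distD (c (gam 0)) _ _) _.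
  by rewrite /rho addrC lerD2l ler_pdivlMr // mulrC.
have /nbhs_ballP[d /= d0 dO] := cgt0 _ (oO _ Ot0).
have [t [t_01 nOt] tlt] : exists2 t, Bad t & t < t0 + d.
  by apply: inf_adherent.
have t0t : t0 <= t by apply: ge_inf.
apply: nOt; apply: dO; rewrite -ball_normE /ball_ /= distrC ger0_norm.
  by rewrite ltrBlDl.
by rewrite subr_ge0.
Qed.

Lemma piecewise_confined (s : seq (R -> X)) (p q : X) (l : R) :
  piecewise_C1 A p q s -> chart_dom c p -> kap * `|c p - x0| + l < kap * r ->
  (piecewise_length h s <= l%:E)%E ->
  chart_dom c q /\ kap * `|c q - c p| <= l.
Proof.
elim: s p l => [|gam s IH] p l /=.
  move=> <- cp _; rewrite /piecewise_length big_nil lee_fin => l0.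
  by rewrite subrr normr0 mulr0.
move=> [Cgam <- Cs] cp small.
rewrite /piecewise_length big_cons -/(piecewise_length h s).
have g0 := curve_length_ge0 gam.
have s0 : (0 <= piecewise_length h s)%E.
  by apply: sume_ge0 => g _; exact: curve_length_ge0.
move=> len.
have [a aE] : exists a : R, curve_length h gam = a%:E.
  have : (curve_length h gam <= l%:E)%E by apply: le_trans len; exact: leeDl.
  by case: (curve_length h gam) g0 => // a _ _; exists a.
rewrite aE in g0 len; rewrite lee_fin in g0.
have sl : (piecewise_length h s <= (l - a)%:E)%E.
  by rewrite EFinB leeBrDl.
have l_a : 0 <= l - a by rewrite -lee_fin (le_trans s0).
have lena : (curve_length h gam <= a%:E)%E by rewrite aE.
have small1 : kap * `|c (gam 0) - x0| + a < kap * r.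
  by apply: le_lt_trans small; rewrite lerD2l -subr_ge0.
have [c1 d1] := curve_confined Cgam cp small1 lena.
have tri : kap * `|c (gam 1) - x0| <= a + kap * `|c (gam 0) - x0|.
  apply: (@le_trans _ _ (kap * (`|c (gam 1) - c (gam 0)| + `|c (gam 0) - x0|))).
    by rewrite ler_pM2l //; exact: ler_distD.
  by rewrite mulrDr lerD2r.
have small2 : kap * `|c (gam 1) - x0| + (l - a) < kap * r.
  by apply: le_lt_trans small; lra.
have [cq dq] := IH (gam 1) (l - a) Cs c1 small2 sl.
split=> //; apply: (@le_trans _ _
  (kap * (`|c q - c (gam 1)| + `|c (gam 1) - c (gam 0)|))).
  by rewrite ler_pM2l //; exact: ler_distD.
by rewrite mulrDr -(subrK a l) lerD.
Qed.

Lemma riemannian_distance_lower (p q : X) (l : R) :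
  chart_dom c p -> kap * `|c p - x0| + l < kap * r ->
  (riemannian_distance h p q < l%:E)%E ->
  chart_dom c q /\ kap * `|c q - c p| <= l.
Proof.
move=> cp small /ereal_inf_lt [_ [s Cs <-]] /ltW sl.
exact: piecewise_confined Cs cp small sl.
Qed.

End Confinement.

(** * Independence of point values from representatives *)

Lemma mean_value_bound (R : realType) n (D : set 'rV[R]_n) (f : 'rV[R]_n -> R)
    (y z : 'rV[R]_n) (B : R) : open D -> smooth_on D f ->
  (forall s : R, `|s| <= 1 -> D (y + s *: (z - y))) ->
  (forall s : R, `|s| <= 1 -> \sum_j `|'D_('e_j) f (y + s *: (z - y))| <= B) ->
  `|f z - f y| <= B * `|z - y|.
Proof.
move=> oD sf inD DB.
have df s : `|s| <= 1 -> differentiable f (y + s *: (z - y)).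
  by move=> s1; apply: smooth_on_differentiable oD sf _; exact: inD.
have [|s s1 E] := @MVT_line R _ f y (z - y) 1.
  by move=> s; rewrite normr1 => s1; apply: diff_derivable; exact: df.
rewrite normr1 in s1.
have -> : f z - f y = 'D_(z - y) f (y + s *: (z - y)).
  by rewrite -[RHS]mul1r -E scale1r [y + _]addrC subrK.
rewrite deriveE ?diff_coords; [|exact: df..].
apply: le_trans (ler_norm_sum _ _ _) _.
apply: le_trans (ler_wpM2r (normr_ge0 _) (DB s s1)).
rewrite mulr_suml; apply: ler_sum => j _; rewrite normrZ mulrC.
by rewrite ler_wpM2l // coord_le_norm.
Qed.

Section Lipschitz.
Variables (R : realType) (n : nat) (X : topologicalType).
Variables (A : smooth_atlas R n X) (h : riemannian_metric A) (k : scalar_field).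
Hypothesis hX : hausdorff_space X.

Lemma moderate_gradient_locO (u : Ieps R -> Cinf A k) c x :
  moderate u -> charts A c -> chart_img c x -> exists N : nat,
  locO x (fun eps y =>
      \sum_(i < n) absK (pderivsK [:: i] (u eps \o chart_inv c) y))
    (fun e => e ^- N).
Proof.
move=> mu Ac cx.
have [N HN] := fin_all_exists
  (fun i : 'I_n => moderate_locO hX [:: i] mu Ac cx).
exists (\max_i N i)%N; apply: locO_sum => i.
by apply: locO_weaken (HN i); exact: leq_bigmax.
Qed.

(** For [d_h(a, b)] small the whole chart segment from [a] to [b] lies in a ball
    where the gradient of [u_eps] is bounded by [C * eps ^- N], and its length
    is at most [d_h(a, b) / kap]. *)
Lemma moderate_lipschitz (u : Ieps R -> Cinf A k) (x : X) : moderate u ->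
  exists2 V, nbhs x V & exists (N : nat) (C eta : R),
    [/\ 0 <= C, 0 < eta & forall eps : Ieps R, val eps < eta ->
      forall a b l, V a -> 0 < l < eta ->
      (riemannian_distance h a b < l%:E)%E ->
      absK (u eps a - u eps b) <= C * val eps ^- N * l].
Proof.
move=> mu; have [c Ac cx] := charts_cover A x.
have cix : chart_img c (c x) by exact: chart_img_map.
have oc : open (chart_img c) by exact: chart_open_img.
have [kap kap0 nearG] : exists2 kap : R, 0 < kap & \forall y \near c x,
    forall v, kap * `|v| <= Num.sqrt (quad (gram h c y) v).
  apply: quad_lower_near => [i j|v v0]; last exact: gram_pos.
  exact: smooth_on_continuous (gram_smooth h Ac i j) cix.
have [N [W xW [C [eta [eta0 HC]]]]] := moderate_gradient_locO mu Ac cix.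
have [r r0 rP] : exists2 r, 0 < r & cball (c x) r `<=` chart_img c `&`
    [set y | forall v, kap * `|v| <= Num.sqrt (quad (gram h c y) v)] `&` W.
  by apply: nbhs_cball_sub; do 2 apply: filterI => //; exact: open_nbhs_nbhs.
exists (chart_dom c `&` c @^-1` cball (c x) (r / 2)).
  by apply: nbhs_chart_preimage => //; apply: nbhs_cball; rewrite divr_gt0.
pose eta' := Num.min eta (kap * (r / 2)).
have eta'0 : 0 < eta' by rewrite lt_min eta0 mulr_gt0 // divr_gt0.
exists N, (2 * `|C| / kap), eta'.
split=> // [|eps epse a b l [ca ra] /andP[l0 le] dab].
  by rewrite !mulr_ge0 // invr_ge0 ltW.
have [cb kb] : chart_dom c b /\ kap * `|c b - c a| <= l.
  apply: (riemannian_distance_lower hX Ac kap0 (x0 := c x) (r := r)) dab => //.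
  - by move=> y /rP[[]].
  - by move=> y /rP[[]].
  - have lk : l < kap * (r / 2).
      by apply: lt_le_trans le _; rewrite ge_min lexx orbT.
    by rewrite [r in ltRHS]splitr mulrDr ler_ltD // ler_pM2l.
have lk : l <= kap * (r / 2).
  by apply: ltW; apply: lt_le_trans le _; rewrite ge_min lexx orbT.
have ba : `|c b - c a| <= r / 2.
  by rewrite -(ler_pM2l kap0); apply: le_trans kb lk.
have seg (s : R) : `|s| <= 1 -> cball (c x) r (c a + s *: (c b - c a)).
  move=> s1; rewrite /cball /= addrAC [r]splitr.
  apply: le_trans (ler_normD _ _) _.
  apply: lerD => //; rewrite normrZ -[leRHS]mul1r; exact: ler_pM.
have {}HC y : W y ->
    \sum_(i < n) absK (pderivsK [:: i] (u eps \o chart_inv c) y) <=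
    `|C| * val eps ^- N.
  have /andP[e0 _] := valP eps.
  move=> Wy; apply: le_trans (ler_norm _) _.
  apply: (@le_trans _ _ (C * val eps ^- N)); last first.
    by rewrite ler_wpM2r ?ler_norm // invr_ge0 exprn_ge0 // ltW.
  by apply: HC => //; apply: lt_le_trans epse _; rewrite ge_min lexx.
have := Cinf_smooth (u eps); rewrite inE => /(_ c Ac)[sre sim].
have part (f : 'rV[R]_n -> R) : smooth_on (chart_img c) f ->
    (forall (i : 'I_n) y,
       `|'D_('e_i) f y| <= absK (pderivsK [:: i] (u eps \o chart_inv c) y)) ->
    `|f (c b) - f (c a)| <= `|C| / kap * val eps ^- N * l.
  move=> sf Df.
  have : `|f (c b) - f (c a)| <= (`|C| * val eps ^- N) * `|c b - c a|.
    apply: (mean_value_bound oc sf) => s /seg /rP[[cs _] Ws] //.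
    by apply: le_trans (HC _ Ws); apply: ler_sum.
  have /andP[e0 _] := valP eps.
  move=> /le_trans; apply.
  have -> : `|C| / kap * val eps ^- N * l =
    (`|C| * val eps ^- N) * (l / kap) by ring.
  rewrite ler_wpM2l ?mulr_ge0 ?invr_ge0 ?exprn_ge0 ?(ltW e0) //.
  by rewrite ler_pdivlMr // mulrC.
have re := part _ sre (fun i y => pderivs_re_le_absK [:: i] _ y).
have im := part _ sim (fun i y => pderivs_im_le_absK [:: i] _ y).
rewrite /absK distrC -/(absK _); apply: le_trans (absK_le _) _.
rewrite reKB imKB; move: re im; rewrite /= !chart_mapK // => re im.
apply: le_trans (lerD re im) _.
by have -> : 2 * `|C| / kap * val eps ^- N * l =
  `|C| / kap * val eps ^- N * l + `|C| / kap * val eps ^- N * l by ring.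
Qed.

End Lipschitz.

Section PointValues.
Variables (R : realType) (n : nat) (X : topologicalType).
Variables (A : smooth_atlas R n X) (h : riemannian_metric A) (k : scalar_field).
Hypothesis hX : hausdorff_space X.

Lemma riemannian_distance_refl (p : X) : (riemannian_distance h p p <= 0)%E.
Proof.
apply: ereal_inf_lbound; exists [::] => //.
by rewrite /piecewise_length big_nil.
Qed.

Lemma equiv_nets_refl (p : csnets R X) : equiv_nets h p p.
Proof.
by move=> m _; apply: bigO_le0 => eps; exact: riemannian_distance_refl.
Qed.

(** The distance [O(eps ^ (M + m + 1))] absorbs the Lipschitz constant
    [O(eps ^- M)]; compactness of the support makes [M] independent of [eps]. *)
Lemma eval_net_equiv (u : moderate_nets A k) (p q : csnets R X) :
  equiv_nets h p q ->
  negligible_num (eval_net u p) -> negligible_num (eval_net u q).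
Proof.
move=> pq np m.
have mu : moderate u by have := mnet_moderate u; rewrite inE.
have [L [eta [cL eta0 pL]]] := svalP p.
pose P (M : nat) (a : X) := forall eps : Ieps R, val eps < M.+1%:R^-1 ->
  forall b l, 0 < l < M.+1%:R^-1 -> (riemannian_distance h a b < l%:E)%E ->
  absK (u eps a - u eps b) <= M%:R * val eps ^- M * l.
have [M HM] : exists M, forall a, L a -> P M a.
  apply: (compact_eventually cL) => x Lx.
  have [V xV [N [C [et [C0 et0 H]]]]] := moderate_lipschitz h hX x mu.
  have [N1 N1C] := archi_bound C; have [N2 N2e] := archi_invS et0.
  exists V => //; exists (maxn N (maxn N1 N2)) => M.
  rewrite !geq_max => /and3P[NM N1M N2M].
  have Met : M.+1%:R^-1 <= et.
    by apply: le_trans N2e; rewrite lef_pV2 ?posrE ?ltr0n // ler_nat.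
  move=> a Va eps epsM b l /andP[l0 lM] dab.
  apply: le_trans (H eps (lt_le_trans epsM Met) a b l Va _ dab) _.
    by rewrite l0 (lt_le_trans lM).
  rewrite ler_wpM2r ?(ltW l0) //; apply: ler_pM => //.
  - by have /andP[e0 _] := valP eps; rewrite invr_ge0 exprn_ge0 // ltW.
  - by apply: le_trans N1C _; rewrite ler_nat.
  - exact: expNr_weaken (valP eps) NM.
have [C1 [eta1 [eta10 H1]]] := pq (M + m).+1 isT.
have [C0 [eta2 [eta20 H2]]] := np m.
pose B := `|C1| + 1.
have B0 : 0 < B by rewrite ltr_wpDl.
pose dl := (M.+1%:R * B)^-1.
have dl0 : 0 < dl by rewrite invr_gt0 mulr_gt0.
exists (C0 + M%:R * B),
  (Num.min (Num.min eta eta1) (Num.min eta2 (Num.min dl M.+1%:R^-1))).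
split; first by rewrite !lt_min eta0 eta10 eta20 dl0 invr_gt0 ltr0n.
move=> eps; rewrite !lt_min.
move=> /andP[/andP[/pL Lp /H1 dpq] /and3P[/H2 up ed eM]].
have /andP[e0 e1] := valP eps; set e := val eps in e0 e1 dpq up ed eM *.
rewrite lee_fin in up; rewrite lee_fin.
pose l := B * e ^+ (M + m).+1.
have l0 : 0 < l by rewrite mulr_gt0 // exprn_gt0.
have lM : l < M.+1%:R^-1.
  apply: (@le_lt_trans _ _ (B * e)).
    by rewrite ler_pM2l // exprS ler_piMr ?(ltW e0) // exprn_ile1 // ltW.
  by rewrite -ltr_pdivlMl // mulrC -invfM.
have dl_ : (riemannian_distance h (sval p eps) (sval q eps) < l%:E)%E.
  apply: le_lt_trans dpq _; rewrite lte_fin ltr_pM2r ?exprn_gt0 //.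
  by apply: le_lt_trans (ler_norm _) _; rewrite ltrDl.
have := HM _ Lp eps eM _ l _ dl_; rewrite l0 lM => /(_ isT) lip.
have -> : eval_net u q eps =
    eval_net u p eps - (u eps (sval p eps) - u eps (sval q eps)).
  by rewrite subKr.
apply: le_trans (absKB _ _) _; rewrite mulrDl; apply: lerD => //.
apply: le_trans lip _; rewrite -/e /l exprS exprD.
have -> : M%:R * e ^- M * (B * (e * (e ^+ M * e ^+ m))) =
    M%:R * B * e ^+ m * e.
  by field; rewrite expf_neq0 ?gt_eqF.
by rewrite ler_piMr // !mulr_ge0 ?exprn_ge0 // ltW.
Qed.

End PointValues.

(** * The point value characterization *)

Lemma quot_pi_eq0 (V : zmodType) (I : zmodClosed V) (x : V) :
  ((\pi_(Quotient.quot I) x)%qT = 0) <-> x \in I.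
Proof.
have <- : (\pi_(Quotient.quot I) 0)%qT = 0 by rewrite ring_quotient.pi_zeror.
by rewrite -[in X in _ <-> X](subr0 x) Quotient.idealrBE; split=> /eqP.
Qed.

(** The net of points picks, for each [eps], a point of [L] where the estimate
    [eps ^ m] fails whenever there is one.  Since [u] is even [O(eps ^ (m + 1))]
    along this net, for small [eps] there was none. *)
Lemma unifO_of_point_values (R : realType) n (X : topologicalType)
    (A : smooth_atlas R n X) k (u : moderate_nets A k) :
  (forall p : csnets R X, negligible_num (eval_net u p)) ->
  forall (L : set X) (m : nat), compact L ->
    unifO L (fun eps q => absK (u eps q)) (fun e => e ^+ m).
Proof.
move=> nu L m cL.
have [[x0 Lx0]|L0] := pselect (L !=set0); last first.
  by exists 0, 1; split=> // eps _ y Ly; exfalso; apply: L0; exists y.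
pose bad eps := [set q | L q /\ val eps ^+ m < absK (u eps q)].
have [p pP] : exists p : Ieps R -> X, forall eps, L (p eps) /\
    ((exists q, bad eps q) -> bad eps (p eps)).
  have H eps : exists q, L q /\ ((exists q, bad eps q) -> bad eps q).
    have [[q Bq]|nB] := pselect (exists q, bad eps q).
      by exists q; split=> //; case: Bq.
    by exists x0.
  exists (fun eps => projT1 (cid (H eps))) => eps.
  exact: projT2 (cid (H eps)).
have cp : compactly_supported p.
  by exists L, 1; split=> // eps _; have [] := pP eps.
have [C [eta [eta0 HC]]] := nu (exist _ p cp) m.+1.
have C0 : 0 < `|C| + 1 by rewrite ltr_wpDl.
exists 1, (Num.min eta (`|C| + 1)^-1).
split; first by rewrite lt_min eta0 invr_gt0.
move=> eps; rewrite lt_min => /andP[/HC + eC] y Ly.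
have /andP[e0 e1] := valP eps.
rewrite lee_fin /eval_net /= => pC.
rewrite ger0_norm ?absK_ge0 // mul1r leNgt; apply/negP => Hy.
have [_ /(_ (ex_intro _ y (conj Ly Hy)))[_]] := pP eps.
rewrite ltNge => /negP; apply; apply: le_trans pC _.
rewrite exprS mulrA ler_piMl ?exprn_ge0 ?(ltW e0) //.
apply: (@le_trans _ _ ((`|C| + 1) * val eps)).
  by rewrite ler_pM2r // (le_trans (ler_norm _)) // lerDl.
by rewrite -ler_pdivlMl // mulr1 ltW.
Qed.

Theorem theorem1 (R : realType) (k : scalar_field) (n : nat)
    (X : topologicalType) (A : smooth_atlas R n X)
    (X_hausdorff : hausdorff_space X) (X_paracompact : paracompact X)
    (h : riemannian_metric A) (U : colombeau_algebra A k) :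
  U = 0 <-> forall p : generalized_points h, point_value U p = 0.
Proof.
have UE : U = 0 <-> negligible_net (repr U).
  by rewrite -{1}[U]reprK quot_pi_eq0 inE.
have vE (p : generalized_points h) : point_value U p = 0 <->
    negligible_num (eval_net (repr U) (gp_repr p)).
  by rewrite /point_value quot_pi_eq0 inE.
rewrite UE; split=> [nU p|vU].
  apply/vE => m; case: (gp_repr p) => p' [L [eta [cL eta0 pL]]].
  have [C [eta' [eta'0 H]]] := nU L id m cL (diffop_id A k).
  exists C, (Num.min eta eta'); split; first by rewrite lt_min eta0.
  move=> eps; rewrite lt_min => /andP[/pL Lp /H]; apply: le_trans.
  by apply: ereal_sup_ubound; exists (p' eps).
have mU : moderate (repr U) by have := mnet_moderate (repr U); rewrite inE.
have nU (p : csnets R X) : negligible_num (eval_net (repr U) p).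
  pose P : generalized_points h :=
    exist _ [set q | equiv_nets h p q] (ex_intro _ p erefl).
  apply: (@eval_net_equiv _ _ _ _ h _ X_hausdorff (repr U) (gp_repr P));
    last exact/vE.
  have PE : [set q | equiv_nets h p q] =
      [set q | equiv_nets h (gp_repr P) q].
    exact: (projT2 (cid (proj2_sig P))).
  have : [set q | equiv_nets h p q] p by exact: equiv_nets_refl.
  by rewrite PE.
apply: negligible_of_locO => // p m.
have [K pK cK] := compact_nbhs_chart A p.
by exists K => //; exact: unifO_of_point_values.
Qed.
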